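(* Let $G=\langle X\mid R\rangle$ be a group with $X$ finite and $R$ not necessarily finite. Suppose that there exist a set $P$ of infinitely many primes, a freely reduced $X$-word $w$ (the same for all $p\in P$), and a collection $\{\Gamma_p\}_{p\in P}$ of $X$-graphs such that for every $p\in P$: $\Gamma_p$ is an $X$-regular connected $X$-graph which fulfills the defining relators $R$ and has exactly $p$ vertices, and there is a base-vertex $v$ of $\Gamma_p$ such that $$\{t(p_i)\mid 0\le i<p\}=V(\Gamma_p),$$ where $p_i$ denotes the reduced path in $\Gamma_p$ with origin $o(p_i)=v$ and label $\mu(p_i)=w^i$. Let $H$ be a finite index subgroup of $G$. Then the nerve complex $\mathcal{NC}(H,\mathscr H_{\mathrm{fi}})$ and the order complex $\Delta P_{\mathrm{fi}}(H)$ are contractible.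
   Context: For a group $H$: $\mathscr H_{\mathrm{fi}}$ is the set of all proper finite index subgroups of $H$, and $P_{\mathrm{fi}}(H)=\{Kh\mid K<H \text{ proper},\ [H:K]<\infty,\ h\in H\}$ is the set of all right cosets of such subgroups, partially ordered by inclusion. The order complex $\Delta P$ of a poset $P$ is the simplicial complex whose $n$-simplices are the chains $C_0\subset C_1\subset\dots\subset C_n$ in $P$. The nerve complex $\mathcal{NC}(H,\mathscr H)$ of a group $H$ with respect to a set $\mathscr H$ of subgroups is the simplicial complex with an $n$-simplex for every set $\{K_0h_0,\dots,K_nh_n\}$ of $n+1$ cosets with $K_i\in\mathscr H$, $h_i\in H$ and $K_0h_0\cap\dots\cap K_nh_n\ne\emptyset$. $F(X)$ is the free group on $X$, realized as the freely reduced words in $X\cup X^{-1}$ (powers $w^i$ are taken in $F(X)$, i.e. freely reduced); $R\subseteq F(X)$. An $X$-graph is a directed graph $\Gamma$ (loops and multiple edges allowed) in which every directed edge $e$, with origin $o(e)$ and terminus $t(e)$, carries a label $\mu(e)\in X$. $\widehat\Gamma$ is obtained by adding, for each edge $e$, a formal inverse $e^{-1}$ with $o(e^{-1})=t(e)$, $t(e^{-1})=o(e)$, $\mu(e^{-1})=\mu(e)^{-1}$. A path $p$ in $\Gamma$ is a sequence $e_1,\dots,e_k$ of edges of $\widehat\Gamma$ with $o(e_i)=t(e_{i-1})$; $o(p)=o(e_1)$, $t(p)=t(e_k)$, $\mu(p)=\mu(e_1)\cdots\mu(e_k)$; a single vertex is also a path, with empty label. A path is reduced if it has no subpath $e,e^{-1}$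 with $e$ an edge of $\widehat\Gamma$. $\Gamma$ is $X$-regular if for every vertex $v$ and every $x\in X\cup X^{-1}$ there is exactly one edge in $\widehat\Gamma$ with origin $v$ and label $x$. $\Gamma$ fulfills the defining relators $R$ if for every vertex $v$ and every $r\in R$, each reduced path with origin $v$ and label $r$ has terminus $v$. *)

(* Defs.v *)
From HB Require Import structures.
From mathcomp Require Import all_boot all_order all_algebra.
From mathcomp Require Import all_classical all_reals all_analysis.

Set Implicit Arguments.
Unset Strict Implicit.
Unset Printing Implicit Defensive.

Import Order.TTheory GRing.Theory Num.Theory.
Import numFieldNormedType.Exports.

Local Open Scope classical_set_scope.

(** * Free groups, as groups of freely reduced words *)

(** The letter [(x, false)] stands for [x] and [(x, true)] for [x^-1]. *)
Definition letter (X : Type) : Type := (X * bool)%type.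

Definition letter_inv (X : Type) (a : letter X) : letter X := (a.1, ~~ a.2).

Lemma letter_invK (X : Type) : involutive (@letter_inv X).
Proof. by case=> x b; rewrite /letter_inv /= negbK. Qed.

Section FreeGroup.
Variable X : choiceType.
Implicit Types (a b : letter X) (s t u v : seq (letter X)).

Definition freely_reduced s : bool :=
  sorted (fun a b => b != letter_inv a) s.

Record freegroup : Type :=
  FreeGroup { word :> seq (letter X); wordP : freely_reduced word }.

HB.instance Definition _ := [isSub for word].
HB.instance Definition _ := [Choice of freegroup by <:].

(** Left multiplication of a freely reduced word by a letter. *)
Definition push a s : seq (letter X) :=
  if s is b :: t then (if b == letter_inv a then t else a :: s) else [:: a].

(** For [v] freely reduced, the free reduction of the concatenation [u ++ v]. *)
Definition reduced_cat u v : seq (letter X) := foldr push v u.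

Definition word_inv u : seq (letter X) := rev (map (@letter_inv X) u).

Lemma freely_reduced_behead a s : freely_reduced (a :: s) -> freely_reduced s.
Proof. by case: s => //= b s /andP[]. Qed.

Lemma freely_reduced_push a s : freely_reduced s -> freely_reduced (push a s).
Proof.
case: s => //= b t bt; case: ifPn => [_|ba] /=; last by rewrite ba.
exact: (@freely_reduced_behead b).
Qed.

Lemma freely_reduced_cat u v :
  freely_reduced v -> freely_reduced (reduced_cat u v).
Proof. by move=> vr; elim: u => //= a u; apply: freely_reduced_push. Qed.

Lemma pushK a s : freely_reduced s -> push (letter_inv a) (push a s) = s.
Proof.
case: s => [|b t] /=; first by rewrite letter_invK eqxx.
case: ifPn => [/eqP ->|_ _] /=; last by rewrite letter_invK eqxx.
by case: t => //= c t /andP[/negPf ->].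
Qed.

Lemma reduced_cat_push a u s : freely_reduced s ->
  reduced_cat (push a u) s = push a (reduced_cat u s).
Proof.
move=> sr; case: u => //= b t; case: ifPn => // /eqP ->.
by rewrite -[in X in push X _](letter_invK a) pushK // freely_reduced_cat.
Qed.

Lemma reduced_catA u v s : freely_reduced s ->
  reduced_cat u (reduced_cat v s) = reduced_cat (reduced_cat u v) s.
Proof.
by move=> sr; elim: u => //= a u ->; rewrite reduced_cat_push.
Qed.

Lemma reduced_cats0 u : freely_reduced u -> reduced_cat u [::] = u.
Proof.
elim: u => //= a u IHu au; rewrite IHu ?(freely_reduced_behead au) //.
by case: u au {IHu} => //= b u /andP[/negPf ->].
Qed.

Lemma reduced_catVK u s : freely_reduced s ->
  reduced_cat (word_inv u) (reduced_cat u s) = s.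
Proof.
move=> sr; elim: u => //= a u IHu.
rewrite /word_inv /= rev_cons /reduced_cat foldr_rcons.
by rewrite pushK ?freely_reduced_cat.
Qed.

Lemma word_invK : involutive word_inv.
Proof.
by move=> u; rewrite /word_inv map_rev revK mapK //; apply: letter_invK.
Qed.

Lemma freely_reduced_inv u : freely_reduced u -> freely_reduced (word_inv u).
Proof.
rewrite /freely_reduced /word_inv rev_sorted sorted_map; apply: sub_sorted.
move=> a b /=; apply: contraNN => /eqP E.
by rewrite -(letter_invK b) -E.
Qed.

Definition freegroup_one : freegroup := @FreeGroup [::] isT.
Definition freegroup_mul (u v : freegroup) : freegroup :=
  FreeGroup (freely_reduced_cat u (wordP v)).
Definition freegroup_inv (u : freegroup) : freegroup :=
  FreeGroup (freely_reduced_inv (wordP u)).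

Lemma freegroup_mulA : associative freegroup_mul.
Proof. by move=> u v s; apply: val_inj; apply: reduced_catA (wordP s). Qed.

Lemma freegroup_mul1g : left_id freegroup_one freegroup_mul.
Proof. by move=> u; apply: val_inj. Qed.

Lemma freegroup_mulg1 : right_id freegroup_one freegroup_mul.
Proof. by move=> u; apply: val_inj; apply: reduced_cats0 (wordP u). Qed.

Lemma freegroup_mulVg :
  left_inverse freegroup_one freegroup_inv freegroup_mul.
Proof.
move=> u; apply: val_inj => /=.
by rewrite -[in X in reduced_cat _ X](reduced_cats0 (wordP u)) reduced_catVK.
Qed.

Lemma freegroup_mulgV :
  right_inverse freegroup_one freegroup_inv freegroup_mul.
Proof.
move=> u; rewrite -{1}[u](_ : freegroup_inv (freegroup_inv u) = u).
  exact: freegroup_mulVg.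
by apply: val_inj; apply: word_invK.
Qed.

HB.instance Definition _ := isGroup.Build freegroup
  freegroup_mulA freegroup_mul1g freegroup_mulg1
  freegroup_mulVg freegroup_mulgV.

End FreeGroup.

(** * Subgroups, cosets and presentations *)

Section Subgroups.
Variable G : groupType.
Implicit Types (H K N : set G) (Hs : set (set G)).

Definition subgroup K : Prop := group_closed [in K].

Definition normal_subgroup N : Prop :=
  subgroup N /\ forall n g, N n -> N (n ^ g)%g.

Definition normal_closure (A : set G) : set G := smallest normal_subgroup A.

Definition right_coset K (h : G) : set G := [set (k * h)%g | k in K].

(** The cosets [Kh] with [K] in [Hs] and [h] in [H]. *)
Definition right_cosets H Hs : set (set G) :=
  [set C | exists K h, [/\ Hs K, H h & C = right_coset K h]].

(** For subgroups [K <= H] of [G]. *)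
Definition finite_index H K : Prop := finite_set (right_cosets H [set K]).

Definition proper_finite_index_subgroups H : set (set G) :=
  [set K | [/\ subgroup K, K `<` H & finite_index H K]].

Definition proper_finite_index_cosets H : set (set G) :=
  right_cosets H (proper_finite_index_subgroups H).

End Subgroups.

Definition letter_eval (X : Type) (G : groupType) (gen : X -> G)
    (a : letter X) : G :=
  (if a.2 then (gen a.1)^-1 else gen a.1)%g.

Definition freegroup_eval (X : choiceType) (G : groupType) (gen : X -> G)
    (u : freegroup X) : G :=
  (\prod_(a <- word u) letter_eval gen a)%g.

Lemma freegroup_evalM (X : choiceType) (G : groupType) (gen : X -> G) :
  {morph freegroup_eval gen : u v / (u * v)%g}.
Proof.
have evalV a : (letter_eval gen a * letter_eval gen (letter_inv a) = 1)%g.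
  by case: a => x [] /=; rewrite /letter_eval /= ?mulVg ?mulgV.
case=> u ur v; rewrite /freegroup_eval /= /reduced_cat.
elim: u {ur} => [|a u IHu] /=; first by rewrite big_nil mul1g.
rewrite big_cons -mulgA -IHu; case: (foldr _ _ _) => [|b t] /=.
  by rewrite big_cons.
by case: eqP => [->|_]; rewrite !big_cons // mulgA evalV mul1g.
Qed.

(** [G = < X | rels >], where [gen] maps each generator to its image in [G]. *)
Definition presentation (X : choiceType) (rels : set (freegroup X))
    (G : groupType) (gen : X -> G) : Prop :=
  range (freegroup_eval gen) = [set: G] /\
  freegroup_eval gen @^-1` [set 1%g] = normal_closure rels.

(** * Labelled directed graphs *)

Record xgraph (X : Type) : Type := XGraph {
  vertex : Type;
  edge : Type;
  origin : edge -> vertex;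
  terminus : edge -> vertex;
  label : edge -> X }.

Section XGraphs.
Variables (X : choiceType) (Gamma : xgraph X).

(** The edges of the graph with formal inverses; [(e, false)] stands for [e]
    and [(e, true)] for its formal inverse. *)
Definition hedge : Type := (edge Gamma * bool)%type.

Implicit Types (e f : hedge) (v : vertex Gamma) (p : seq hedge).

Definition hedge_inv e : hedge := (e.1, ~~ e.2).
Definition horigin e : vertex Gamma :=
  if e.2 then terminus e.1 else origin e.1.
Definition hterminus e : vertex Gamma :=
  if e.2 then origin e.1 else terminus e.1.
Definition hlabel e : letter X := (label e.1, e.2).

(** [p] is a path with origin [v]; [[::]] is the one-vertex path at [v]. *)
Fixpoint path_from v p : Prop :=
  if p is e :: q then horigin e = v /\ path_from (hterminus e) q else True.

Definition path_terminus v p : vertex Gamma := last v (map hterminus p).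

Definition path_label p : seq (letter X) := map hlabel p.

Definition reduced_path p : Prop :=
  forall p1 e p2, p <> p1 ++ [:: e, hedge_inv e & p2].

Definition xconnected : Prop :=
  forall u v, exists p, path_from u p /\ path_terminus u p = v.

Definition xregular : Prop :=
  forall v (a : letter X), exists! e : hedge, horigin e = v /\ hlabel e = a.

Definition fulfills_relators (rels : set (freegroup X)) : Prop :=
  forall v (r : freegroup X), rels r -> forall p,
    path_from v p -> reduced_path p -> path_label p = word r ->
    path_terminus v p = v.

(** The termini of the reduced paths with origin [v] and label [w ^+ i],
    [0 <= i < n]. *)
Definition power_termini v (w : freegroup X) (n : nat) : set (vertex Gamma) :=
  [set u | exists2 i : nat, (i < n)%N & exists p,
     [/\ path_from v p, reduced_path p, path_label p = word (w ^+ i)%g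
       & path_terminus v p = u]].

End XGraphs.

(** * Abstract simplicial complexes *)

Record simplicial_complex (V : Type) : Type := SimplicialComplex {
  simplex : set (set V);
  simplex_finite : forall S, simplex S -> finite_set S;
  simplex_neq0 : forall S, simplex S -> S !=set0;
  simplex_face : forall S T,
    simplex S -> T `<=` S -> T !=set0 -> simplex T }.

Section NerveComplex.
Variables (G : groupType) (H : set G) (Hs : set (set G)).

Definition nerve_simplices : set (set (set G)) :=
  [set S | [/\ finite_set S, S !=set0, S `<=` right_cosets H Hs
             & \bigcap_(C in S) C !=set0]].

Lemma nerve_finite S : nerve_simplices S -> finite_set S.
Proof. by case. Qed.

Lemma nerve_neq0 S : nerve_simplices S -> S !=set0.
Proof. by case. Qed.

Lemma nerve_face S T :
  nerve_simplices S -> T `<=` S -> T !=set0 -> nerve_simplices T.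
Proof.
move=> [fS S0 SH [g Sg]] TS T0; split => //.
- exact: sub_finite_set fS.
- exact: subset_trans SH.
- by exists g => C /TS; apply: Sg.
Qed.

Definition nerve_complex : simplicial_complex (set G) :=
  SimplicialComplex nerve_finite nerve_neq0 nerve_face.

End NerveComplex.

Section OrderComplex.
Context (d : Order.disp_t) (T : porderType d).
Variable P : set T.

Definition order_simplices : set (set T) :=
  [set S | exists s : seq T, [/\ s != [::], sorted <%O s,
     [set` s] `<=` P & S = [set` s]]].

Lemma order_finite S : order_simplices S -> finite_set S.
Proof. by move=> [s [_ _ _ ->]]; apply: finite_seq. Qed.

Lemma order_neq0 S : order_simplices S -> S !=set0.
Proof.
by move=> [[|x s] [// _ _ _ ->]]; exists x => /=; rewrite mem_head.
Qed.

Lemma order_face S S' : order_simplices S -> S' `<=` S -> S' !=set0 ->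
  order_simplices S'.
Proof.
move=> [s [_ ss sP ->]] S's [x S'x].
have E : S' = [set` [seq y <- s | y \in S']].
  rewrite eqEsubset; split=> y /=; rewrite mem_filter.
    by move=> yS'; rewrite (mem_set yS'); apply: (S's).
  by case/andP=> /set_mem.
exists [seq y <- s | y \in S']; split=> //.
- by apply/eqP=> s0; move: S'x; rewrite E s0.
- exact: sorted_filter lt_trans _ _ ss.
- by rewrite -E; apply: subset_trans sP.
Qed.

Definition order_complex : simplicial_complex T :=
  SimplicialComplex order_finite order_neq0 order_face.

End OrderComplex.

(** * Geometric realization and contractibility *)

Section Realization.
Local Open Scope ring_scope.
Variables (R : realType) (V : choiceType) (K : simplicial_complex V).

(** A point is given by its barycentric coordinates. *)
Record realization : Type := Realization {
  bary :> V -> R;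
  bary_ge0 : forall v, 0 <= bary v;
  bary_supp : simplex K [set v | bary v != 0];
  bary_sum : \sum_(v \in [set: V]) bary v = 1 }.

HB.instance Definition _ := gen_eqMixin realization.
HB.instance Definition _ := gen_choiceMixin realization.

Definition closed_simplex (S : set V) : set realization :=
  [set x | [set v | x v != 0] `<=` S].

(** The weak topology: a set is open if and only if its trace on each closed
    simplex is open for the Euclidean topology of that simplex. *)
Definition realization_open (U : set realization) : Prop :=
  forall S, simplex K S -> forall x, closed_simplex S x -> U x ->
    exists2 eps : R, 0 < eps &
      forall y, closed_simplex S y ->
        (forall v, S v -> `|x v - y v| < eps) -> U y.

Lemma realization_openT : realization_open setT.
Proof. by move=> S _ x _ _; exists 1. Qed.

Lemma realization_openI : setI_closed realization_open.
Proof.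
move=> A B Ao Bo S KS x Sx [Ax Bx].
have [e e0 eA] := Ao S KS x Sx Ax; have [f f0 fB] := Bo S KS x Sx Bx.
exists (Num.min e f) => [|y Sy xy]; first by rewrite lt_min e0.
by split; [apply: eA => // v /xy | apply: fB => // v /xy];
  rewrite lt_min => /andP[].
Qed.

Lemma realization_open_bigU (I : Type) (f : I -> set realization) :
  (forall i, realization_open (f i)) -> realization_open (\bigcup_i f i).
Proof.
move=> fo S KS x Sx [i _ fix_]; have [e e0 ef] := fo i S KS x Sx fix_.
by exists e => // y Sy xy; exists i => //; apply: ef.
Qed.

HB.instance Definition _ := isOpenTopological.Build realization
  realization_openT realization_openI realization_open_bigU.

End Realization.

(** The identity of [T] is homotopic to a constant map. *)
Definition contractible (R : realType) (T : topologicalType) : Prop :=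
  exists (x0 : T) (F : R * T -> T),
    [/\ {within `[0%R, 1%R] `*` [set: T], continuous F},
        forall x, F (0%R, x) = x & forall x, F (1%R, x) = x0].

(* Main.v *)
Require Import Defs.
From mathcomp Require Import all_boot all_order all_algebra.
From mathcomp Require Import finmap.
From mathcomp Require Import all_classical all_reals all_analysis.
From mathcomp Require Import zify lra.

(** Why the complexes are contractible.

    A group presented on the finite set X has only countably many subgroups of
    finite index, so there is a decreasing sequence L_0 >= L_1 >= ... of finite
    index subgroups of H such that every finite index subgroup of H contains
    some L_n ([countable_finite_index], [cofinal_transversals]).  The graphs supply, for
    each n, a vertex of the nerve that is compatible with everything visible at
    stage n.  Indeed G acts on the p vertices of Gamma_p, and w acts as a
    p-cycle; if p exceeds the index of L_n then some power w^m with 0 < m < p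
    lies in L_n, and it is still transitive because p is prime.  Hence L_n is
    transitive on the vertices, which says that the intersection K_n of H with
    the stabilizer of the base vertex meets every coset of L_n in H, while it is
    proper in H ([stabilizer_transversal]).  A nonempty intersection of cosets
    of subgroups containing L_n is a union of cosets of L_n, so it meets K_n.

    Thus in the nerve the subcomplex of the L_n-invariant cosets lies in a cone
    with apex K_n.  To contract the whole nerve at once, let f_n fix the
    L_(n-1)-invariant cosets and send every other vertex to K_n (with f_0
    constant).  Consecutive maps f_n, f_(n+1) are contiguous once
    L_(n+1) <= L_n /\ K_n, each vertex is fixed by almost all f_n, and an
    infinite telescope of straight-line homotopies, the passage from f_(n+1) to
    f_n taking place during the time interval [1/(n+2), 1/(n+1)], is a
    contraction ([contractible_telescope]).  It is continuous because on a given
    simplex only finitely many of these homotopies are not constant, and because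
    the product of the weak topology with a compact interval is again detected
    on simplices, by the tube lemma ([continuous_homotopy]).

    The order complex has the same vertices as the nerve and is a subcomplex of
    it, since the intersection of a finite chain of cosets is its least member.  Conversely, the barycentric subdivision of the nerve
    maps to the order complex by sending a simplex to the intersection of its
    vertices.  On a chain this intersection is a member of the chain, so that
    the composite self-map of the order complex moves each point within a
    simplex that contains it, and is homotopic to the identity along straight
    lines.  Hence the order complex is dominated by the contractible nerve
    ([contractible_subcomplex]). *)

Set Implicit Arguments.
Unset Strict Implicit.
Unset Printing Implicit Defensive.

Import Order.TTheory GRing.Theory Num.Theory.
Import numFieldNormedType.Exports.

Local Open Scope classical_set_scope.

(** * Finitely supported probability weights *)

Section Weights.
Local Open Scope ring_scope.
Variable R : realType.

Definition supp (A : Type) (c : A -> R) : set A := [set a | c a != 0].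

Definition prob (A : choiceType) (c : A -> R) : Prop :=
  [/\ forall a, 0 <= c a, finite_set (supp c) & \sum_(a \in [set: A]) c a = 1].

(** Points of a realization are probability weights on vertices; [mix c k] is
    the image of the weight [c] under the Markov kernel [k].  Vertex maps are
    the case of Dirac kernels. *)
Definition mix (A B : choiceType) (c : A -> R) (k : A -> B -> R) (b : B) : R :=
  \sum_(a \in [set: A]) c a * k a b.

Definition dirac_at (A B : choiceType) (f : A -> B) (a : A) (b : B) : R :=
  (f a == b)%:R.

Lemma sum_supp (A : choiceType) (c k : A -> R) (S : set A) :
  finite_set S -> supp c `<=` S ->
  \sum_(a \in [set: A]) c a * k a = \sum_(a <- fset_set S) c a * k a.
Proof.
move=> fS cS; rewrite -fsbig_finite //; apply/esym/fsbig_widen => //.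
move=> a [_ nSa]; rewrite /preimage /=; case: (eqVneq (c a) 0) => [->|/cS //].
by rewrite mul0r.
Qed.

Lemma sum_supp1 (A : choiceType) (c : A -> R) (S : set A) :
  finite_set S -> supp c `<=` S ->
  \sum_(a \in [set: A]) c a = \sum_(a <- fset_set S) c a.
Proof.
move=> fS cS; rewrite -fsbig_finite //; apply/esym/fsbig_widen => //.
by move=> a [_ nSa]; apply: contrapT => /eqP/cS.
Qed.

Lemma prob_le1 (A : choiceType) (c : A -> R) a : prob c -> c a <= 1.
Proof.
case=> c0 fc c1; have [->|ca] := eqVneq (c a) 0; first exact: ler01.
rewrite -c1 (sum_supp1 fc) // (big_fsetD1 a) /= ?in_fset_set ?inE //.
by rewrite lerDl sumr_ge0.
Qed.

Lemma prob_neq0 (A : choiceType) (c : A -> R) : prob c -> supp c !=set0.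
Proof.
case=> c0 fc c1; apply: contrapT => /set0P/negP; rewrite negbK => /eqP s0.
move: c1; rewrite (sum_supp1 fc) // s0 fset_set0 big_nil => /esym/eqP.
by rewrite oner_eq0.
Qed.

Lemma prob_dirac (A B : choiceType) (f : A -> B) a : prob (dirac_at f a).
Proof.
have fs : finite_set [set f a] by exact: finite_set1.
have sub : supp (dirac_at f a) `<=` [set f a].
  move=> b; rewrite /supp /dirac_at /=.
  by case: (eqVneq (f a) b) => [->|_] //; rewrite mulr0n eqxx.
split; first by move=> b; rewrite /dirac_at ler0n.
- exact: sub_finite_set fs.
- by rewrite (sum_supp1 fs sub) fset_set1 big_seq_fset1 /dirac_at eqxx.
Qed.

Lemma supp_dirac (A B : choiceType) (f : A -> B) a :
  supp (dirac_at f a) = [set f a].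
Proof.
apply/seteqP; split=> b; rewrite /supp /dirac_at /=.
  by case: (eqVneq (f a) b) => [->|_] //; rewrite mulr0n eqxx.
by move=> ->; rewrite eqxx oner_neq0.
Qed.

(** No cancellation occurs between nonnegative terms; this is what allows
    checking that a mixture lies in a complex by looking at vertices only. *)
Lemma supp_mix (A B : choiceType) (c : A -> R) (k : A -> B -> R) :
  prob c -> (forall a, supp c a -> prob (k a)) ->
  supp (mix c k) = \bigcup_(a in supp c) supp (k a).
Proof.
move=> [c0 fc c1] pk; apply/seteqP; split=> b /=; rewrite /supp /= /mix.
  rewrite (sum_supp (k ^~ b) fc) // => nz; apply: contrapT => nb.
  move/eqP: nz; apply; rewrite big_seq big1 // => a.
  rewrite in_fset_set // inE => ca; apply/eqP; rewrite mulf_eq0.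
  apply/orP; right; apply/negPn/negP => kab; apply: nb; by exists a.
case=> a ca kab; rewrite (sum_supp (k ^~ b) fc) // gt_eqF //.
rewrite (big_fsetD1 a) /= ?in_fset_set ?inE //.
have [ka0 _ _] := pk a ca.
rewrite ltr_pwDl ?mulr_gt0 ?lt_def ?c0 ?ka0 ?andbT //.
rewrite big_seq sumr_ge0 // => i.
rewrite in_fsetD1 in_fset_set // => /andP[_ /set_mem ci].
by rewrite mulr_ge0 //; have [] := pk i ci.
Qed.

Lemma prob_mix (A B : choiceType) (c : A -> R) (k : A -> B -> R) :
  prob c -> (forall a, supp c a -> prob (k a)) -> prob (mix c k).
Proof.
move=> pc pk; have E := supp_mix pc pk; have [c0 fc c1] := pc.
have fm : finite_set (supp (mix c k)).
  by rewrite E; apply: bigcup_finite => // a ca; have [] := pk a ca.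
split=> // [b|].
  rewrite /mix (sum_supp (k ^~ b) fc) // big_seq sumr_ge0 // => a.
  by rewrite in_fset_set // inE => ca; rewrite mulr_ge0 //; have [] := pk a ca.
rewrite (sum_supp1 fm) //; under eq_bigr do rewrite /mix (sum_supp _ fc) //.
rewrite exchange_big /= -c1 (sum_supp1 fc) // big_seq [RHS]big_seq.
apply: eq_bigr => a; rewrite in_fset_set // inE => ca.
have [_ _ k1] := pk a ca.
rewrite -mulr_sumr -(sum_supp1 fm) ?k1 ?mulr1 //.
by rewrite E => b kb; exists a.
Qed.

Lemma mix_id (A : choiceType) (c : A -> R) : prob c -> mix c (dirac_at id) = c.
Proof.
move=> [_ fc _]; apply/funext => a; rewrite /mix.
have fU : finite_set (supp c `|` [set a]) by rewrite finite_setU.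
rewrite (sum_supp (fun b => dirac_at id b a) fU); last by move=> b; left.
rewrite (big_fsetD1 a) /=; last by rewrite in_fset_set // inE; right.
rewrite /dirac_at /= eqxx mulr1 big_seq big1 ?addr0 // => b.
by rewrite in_fsetD1 => /andP[/negPf -> _]; rewrite mulr0.
Qed.

Definition interp (A : Type) (t : R) (c d : A -> R) (a : A) : R :=
  (1 - t) * c a + t * d a.

Lemma supp_interp (A : Type) t (c d : A -> R) :
  supp (interp t c d) `<=` supp c `|` supp d.
Proof.
move=> a; rewrite /supp /interp /=; case: (eqVneq (c a) 0) => [->|]; last by left.
case: (eqVneq (d a) 0) => [->|]; last by right.
by rewrite !mulr0 addr0 eqxx.
Qed.

Lemma prob_interp (A : choiceType) t (c d : A -> R) : 0 <= t <= 1 ->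
  prob c -> prob d -> prob (interp t c d).
Proof.
move=> /andP[t0 t1] [c0 fc c1] [d0 fd d1].
have fcd : finite_set (supp c `|` supp d) by rewrite finite_setU.
have sub := @supp_interp A t c d.
split; first by move=> a; rewrite addr_ge0 // mulr_ge0 // subr_ge0.
- exact: sub_finite_set fcd.
- rewrite (sum_supp1 fcd sub) big_split /= -!mulr_sumr.
  rewrite -(sum_supp1 fcd) ?c1; last by move=> a; left.
  rewrite -(sum_supp1 fcd) ?d1; last by move=> a; right.
  by rewrite !mulr1 subrK.
Qed.

End Weights.

(** * The weak topology of a realization *)

Section RealizationTopology.
Local Open Scope ring_scope.
Variables (R : realType) (V : choiceType) (K : simplicial_complex V).
Implicit Types (x y : realization R K) (S T : set V).

Lemma supp_simplex x : simplex K (supp x).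
Proof. exact: bary_supp. Qed.

Lemma bary_prob x : prob x.
Proof.
split; first exact: bary_ge0.
- exact: simplex_finite (supp_simplex x).
- exact: bary_sum.
Qed.

Lemma bary_inj x y : bary x = bary y -> x = y.
Proof.
case: x y => [c c0 cs c1] [d d0 ds d1] /= E; case: _ / E in d0 ds d1 *.
by congr Realization; exact: Prop_irrelevance.
Qed.

(** Homotopies are easiest to give by their coordinates; the default point [x]
    makes the passage from coordinates to points total. *)
Definition point_of x (c : V -> R) : realization R K :=
  xget x [set y | bary y = c].

Lemma point_ofE x (c : V -> R) : prob c -> simplex K (supp c) ->
  bary (point_of x c) = c.
Proof.
move=> [c0 _ c1] cs; rewrite /point_of.
exact: (@xgetPex _ x [set y | bary y = c]
  (ex_intro _ (Realization c0 cs c1) erefl)).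
Qed.

(** The Euclidean neighbourhoods of [x] in a closed simplex [S].  They are kept
    as a filter on the whole realization so that coordinatewise convergence can
    be treated with the usual calculus of limits. *)
Definition coord_nbhs S x : set_system (realization R K) :=
  [set U | exists2 e : R, 0 < e & forall y, closed_simplex S y ->
     (forall v, S v -> `|x v - y v| < e) -> U y].

#[global] Instance coord_nbhs_filter S x : Filter (coord_nbhs S x).
Proof.
split; first by exists 1.
- move=> A B [e e0 eA] [f f0 fB]; exists (Num.min e f); first by rewrite lt_min e0.
  move=> y Sy xy; split; [apply: eA => // v /xy | apply: fB => // v /xy];
  by rewrite lt_min => /andP[].
- move=> A B AB [e e0 eA]; exists e => // y Sy xy; exact/AB/eA.
Qed.

Lemma coord_nbhs_closed S x : coord_nbhs S x (closed_simplex S).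
Proof. by exists 1. Qed.

Lemma cvg_coord S x v : closed_simplex S x ->
  (fun y : realization R K => y v) @ coord_nbhs S x --> x v.
Proof.
move=> Sx; have [Sv|nSv] := pselect (S v).
  apply/cvgrPdist_lt => e e0.
  by exists e => // y Sy xy; exact: xy.
have z y : closed_simplex S y -> y v = 0.
  by move=> Sy; apply: contrapT => /eqP/Sy.
rewrite (z x Sx); apply: cvg_near_cst.
by exists 1 => // y Sy _; exact: z.
Qed.

(** Registering the weak topology through its open sets makes this equivalence
    hold by computation. *)
Lemma openE_realization (U : set (realization R K)) :
  open U <-> realization_open U.
Proof. by []. Qed.

(** The finite set [T] need not be a simplex.  It has finitely many faces; an
    open set gives a radius for each face that contains [x], and a point that
    is close to [x] cannot lie on a face missing some vertex of [x].  So a map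
    with values on finitely many vertices is continuous as soon as its
    coordinates are, even if its values change from one simplex to another. *)
Lemma open_coord_nbhs (U : set (realization R K)) T x :
  realization_open U -> U x -> finite_set T -> closed_simplex T x ->
  coord_nbhs T x U.
Proof.
move=> oU Ux fT Tx.
(* The faces of [T] are treated one at a time; the support of a nearby point
   is one of them. *)
pose Q (s : {fset V}) := [set y | closed_simplex [set` s] y ->
  simplex K [set` s] -> U y].
have QF : coord_nbhs T x (\bigcap_(s in [set` fpowerset (fset_set T)]) Q s).
  apply: filter_bigI => s; rewrite fpowersetE => /fsubsetP sT.
  have sT' v : v \in s -> T v by move=> /sT; rewrite in_fset_set // inE.
  have [Ks|nKs] := pselect (simplex K [set` s]); last first.
    by apply: filterE => y _ /nKs.
  have [sx|/existsNP[v /not_implyP[xv nsv]]] :=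
    pselect (closed_simplex [set` s] x).
    have [e e0 eU] := oU _ Ks x sx Ux.
    by exists e => // y _ xy sy _; apply: eU => // v /sT'; exact: xy.
  have x0 : 0 < `|x v| by rewrite normr_gt0.
  exists `|x v| => // y Ty xy sy _.
  have yv : y v = 0 by apply: contrapT => /eqP/sy.
  by have := xy v (Tx v xv); rewrite yv subr0 ltxx.
apply: filterS2 (coord_nbhs_closed T x) QF => y Ty.
have fy := simplex_finite (supp_simplex y).
move=> /(_ (fset_set (supp y))); rewrite /Q /= => /(_ _); rewrite fset_setK //.
apply; [|by move=> v|exact: supp_simplex].
rewrite fpowersetE; apply/fsubsetP => v.
by rewrite !in_fset_set // !inE; exact: Ty.
Qed.

End RealizationTopology.

Section Continuity.
Local Open Scope ring_scope.
Variables (R : realType) (V V' : choiceType).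
Variables (K : simplicial_complex V) (K' : simplicial_complex V').

Lemma cvg_open_coord (I : Type) (F : set_system I) (FF : Filter F)
    (f : I -> realization R K') (y : realization R K') (T : set V')
    (U : set (realization R K')) :
  realization_open U -> U y -> finite_set T -> closed_simplex T y ->
  (\forall i \near F, closed_simplex T (f i)) ->
  (forall v, (fun i => f i v) @ F --> y v) ->
  \forall i \near F, U (f i).
Proof.
move=> oU Uy fT Ty Tf cf.
have [e e0 eU] := open_coord_nbhs oU Uy fT Ty.
have H : F (\bigcap_(v in [set` fset_set T]) [set i | `|y v - f i v| < e]).
  by apply: filter_bigI => v _; move/cvgrPdist_lt: (cf v); exact.
apply: filterS2 Tf H => i Ti Hi; apply: eU => // v Tv.
by apply: Hi; rewrite /= in_fset_set // inE.
Qed.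

Definition unit_itv : set R := `[0, 1]%classic.

Lemma continuous_realization (f : realization R K -> realization R K') :
  (forall S, simplex K S -> exists2 T, finite_set T &
     forall y, closed_simplex S y -> closed_simplex T (f y)) ->
  (forall S x v, simplex K S -> closed_simplex S x ->
     (fun y => f y v) @ coord_nbhs S x --> f x v) ->
  continuous f.
Proof.
move=> fT fc; apply/continuousP => U /openE_realization oU.
apply/openE_realization => S KS x Sx Ux.
have [T finT ST] := fT S KS.
apply: (@cvg_open_coord _ (coord_nbhs S x) _ f (f x) T U) => //.
- exact: ST.
- by apply: filterS (coord_nbhs_closed S x) => y; exact: ST.
- by move=> v; apply: fc.
Qed.

(** It is enough to have continuity on the product of the interval with each
    closed simplex, although the product carries the product topology.  For
    [U] open and [J] a compact interval of times around [t0], the points [x]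
    such that [F (t, x)] is in [U] for all [t] in [J] form a weakly open set:
    this may be checked on one simplex at a time, where it is the tube lemma. *)
Lemma continuous_homotopy (F : R * realization R K -> realization R K') :
  (forall S, simplex K S -> exists2 T, finite_set T &
     forall t y, unit_itv t -> closed_simplex S y -> closed_simplex T (F (t, y))) ->
  (forall S t x v, simplex K S -> unit_itv t -> closed_simplex S x ->
     (fun p => F p v) @ filter_prod (within unit_itv (nbhs t)) (coord_nbhs S x)
       --> F (t, x) v) ->
  {within unit_itv `*` [set: realization R K], continuous F}.
Proof.
move=> FT Fc.
have loc U S t x : realization_open U -> simplex K S -> unit_itv t ->
    closed_simplex S x -> U (F (t, x)) ->
    \forall t' \near t & y \near coord_nbhs S x, unit_itv t' -> U (F (t', y)).
  move=> oU KS It Sx Ux; have [T finT ST] := FT S KS.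
  have := @cvg_open_coord _
    (filter_prod (within unit_itv (nbhs t)) (coord_nbhs S x)) _ F (F (t, x)) T U
    oU Ux finT (ST _ _ It Sx).
  case.
  - exists (unit_itv, closed_simplex S).
      by split; [exact: withinT|exact: coord_nbhs_closed].
    by move=> [t' y] [] /=; exact: ST.
  - by move=> v; apply: Fc.
  move=> [A B] [/= At Bx] AB; exists ([set t' | unit_itv t' -> A t'], B) => //.
  by move=> [t' y] [/= It'A By] It'; apply: (AB (t', y)); split=> //=; exact: It'A.
apply/subspace_continuousP => -[t0 x0] [/= It0 _] W.
rewrite /= nbhsE /= => -[U [/openE_realization oU Ux0] UW].
apply: filterS UW _; rewrite /within /= -/(nbhs _).
pose S0 := supp x0; have KS0 : simplex K S0 := supp_simplex x0.
have S0x : closed_simplex S0 x0 by move=> v.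
have [[A B] /= [At Bx] AB] := loc U S0 t0 x0 oU KS0 It0 S0x Ux0.
have /nbhs_ballP[d d0 dA] := At.
have B0 : B x0.
  by case: Bx => e e0; apply=> // v _; rewrite subrr normr0.
(* Half the radius makes the closed interval fit in the open ball. *)
pose J := `[t0 - d / 2, t0 + d / 2]%classic : set R.
pose W' := [set x | forall t, J t -> unit_itv t -> U (F (t, x))].
have Jx : W' x0.
  move=> t Jt; apply: (AB (t, x0)); split => //=; apply: dA.
  rewrite /ball /= ltr_norml; move: Jt; rewrite /J /= in_itv /= => /andP[a b].
  by have d0' : 0 < d by []; lra.
have oW : realization_open W'.
  move=> S KS x Sx W'x.
  (* The tube lemma, as the covering property of the compact set of times. *)
  have Jcpt : near_covering (J `&` unit_itv).
    apply/compact_near_coveringP; apply: compact_closedI; last exact: interval_closed.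
    exact: segment_compact.
  have := Jcpt _ (coord_nbhs S x) (fun y t => unit_itv t -> U (F (t, y))) _.
  case.
    move=> t [Jt It]; apply: loc => //; exact: W'x.
  by move=> e e0 H; exists e => // y Sy xy t Jt It; exact: (H y).
exists (J, W').
  split=> /=; last by exists W'; split => //; exact/openE_realization.
  apply/nbhs_ballP; exists (d / 2).
    by have d_gt0 : 0 < d by []; rewrite /=; lra.
  move=> t; rewrite /ball /= ltr_norml /J /= in_itv /= => /andP[a b].
  by apply/andP; split; lra.
by move=> [t x] [/= Jt W'x] [It _]; exact: W'x.
Qed.

End Continuity.

(** * Infinite telescopes of contiguous vertex maps *)

Section Schedule.
Local Open Scope ring_scope.
Variable R : realType.
Implicit Types (t : R) (j : nat).

(** The part of the [j]-th homotopy that remains to be done at time [t]: 1 up to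
    time 1/(j+2), then affine in [t], and 0 from time 1/(j+1) on. *)
Definition progress j t : R :=
  Num.min 1 (Num.max 0 (j.+2%:R * (1 - j.+1%:R * t))).

(** The index of the homotopy that is under way at time [t], for t in ]0, 1]
    characterized by 1/(stage t + 2) < t <= 1/(stage t + 1). *)
Definition stage t : nat := (Num.truncn t^-1).-1.

Lemma progress_itv j t : 0 <= progress j t <= 1.
Proof. by rewrite /progress le_min ler01 le_max lexx ge_min lexx. Qed.

Lemma progress0 j : progress j 0 = 1.
Proof.
rewrite /progress mulr0 subr0 mulr1; apply/min_idPl.
by rewrite le_max ler1n orbT.
Qed.

Lemma stageP t : 0 < t <= 1 -> (stage t).+1%:R * t <= 1 < (stage t).+2%:R * t.
Proof.
move=> /andP[t0 t1].
have it : 1 <= t^-1 by rewrite invf_ge1.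
have := truncn_itv (le_trans ler01 it).
have : (0 < Num.truncn t^-1)%N by rewrite truncn_gt0.
rewrite /stage; case: (Num.truncn t^-1) => // n _ /= /andP[a b].
by rewrite -ler_pdivlMr // -ltr_pdivrMr // !div1r a b.
Qed.

Lemma progress_before j t : 0 < t <= 1 -> (j < stage t)%N -> progress j t = 1.
Proof.
move=> t01 jJ; have /andP[a _] := stageP t01; have /andP[t0 _] := t01.
apply/min_idPl; rewrite le_max; apply/orP; right.
have b : j.+2%:R * t <= 1.
  by apply: le_trans a; rewrite ler_wpM2r ?(ltW t0) // ler_nat ltnS.
have c : (j.+2%:R : R) = j.+1%:R + 1 by rewrite -natr1.
have d : 0 <= (j.+1%:R : R) by [].
rewrite c in b *; set m := j.+1%:R in b d *.
have : m * ((m + 1) * t) <= m * 1 by rewrite ler_wpM2l.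
nra.
Qed.

Lemma progress_after j t : 0 < t <= 1 -> (stage t < j)%N -> progress j t = 0.
Proof.
move=> t01 jJ; have /andP[_ a] := stageP t01; have /andP[t0 _] := t01.
rewrite /progress; suff -> : Num.max 0 (j.+2%:R * (1 - j.+1%:R * t)) = 0.
  by apply/min_idPr.
apply/max_idPl; rewrite mulr_ge0_le0 // subr_le0.
by apply: le_trans (ltW a) _; rewrite ler_wpM2r ?(ltW t0) // ler_nat ltnS.
Qed.

Lemma stage1 : stage 1 = 0%N.
Proof. by rewrite /stage invr1 truncn1. Qed.

Lemma progress_stage1 : progress (stage 1) 1 = 0 :> R.
Proof. by rewrite stage1 /progress mulr1 subrr mulr0 maxxx min_r. Qed.

Lemma continuous_progress j : continuous (progress j).
Proof.
move=> t; apply: (@continuous_min _ _ (fun=> 1)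
  (fun t => Num.max 0 (j.+2%:R * (1 - j.+1%:R * t)))); first exact: cvg_cst.
apply: (@continuous_max _ _ (fun=> 0) (fun t => j.+2%:R * (1 - j.+1%:R * t))).
  exact: cvg_cst.
apply: cvgM; first exact: cvg_cst.
apply: cvgB; first exact: cvg_cst.
by apply: cvgM; [exact: cvg_cst|exact: cvg_id].
Qed.

(** At each time, all homotopies but one are completed or have not begun, so
    that the telescoping sum reduces to one interpolation.  The left-hand side
    is manifestly continuous in [t], the right-hand side manifestly convex. *)
Lemma sum_progress (g : nat -> R) N t : 0 < t <= 1 ->
  (forall j, (N <= j)%N -> g j = g N) ->
  g 0%N + \sum_(0 <= j < N) progress j t * (g j.+1 - g j) =
  (1 - progress (stage t) t) * g (stage t) +
    progress (stage t) t * g (stage t).+1.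
Proof.
move=> t01 gN; set J := stage t.
(* The sequence [g] is constant from [N] on, so the range may be extended
   beyond the current stage. *)
have -> : \sum_(0 <= j < N) progress j t * (g j.+1 - g j) =
    \sum_(0 <= j < N + J.+1) progress j t * (g j.+1 - g j).
  rewrite [RHS](@big_cat_nat _ _ _ N) ?leq_addr //=.
  rewrite [X in _ = _ + X](_ : _ = 0) ?addr0 // big_nat big1 // => j /andP[Nj _].
  by rewrite !gN ?subrr ?mulr0 // (leq_trans Nj).
rewrite (@big_cat_nat _ _ _ J) ?(leq_trans _ (leq_addl _ _)) //=.
rewrite [X in _ + (X + _)](_ : _ = g J - g 0%N).
  rewrite big_ltn ?(leq_trans _ (leq_addl _ _)) //.
  rewrite [X in _ + (_ + (_ + X))](_ : _ = 0); first by lra.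
  by rewrite big_nat big1 // => j /andP[Jj _]; rewrite progress_after ?mul0r.
rewrite -(telescope_sumr _ (leq0n J)) !big_nat; apply: eq_bigr => j Jj.
by rewrite progress_before ?mul1r.
Qed.

Lemma sum_progress0 (g : nat -> R) N :
  g 0%N + \sum_(0 <= j < N) progress j 0 * (g j.+1 - g j) = g N.
Proof.
under eq_bigr do rewrite progress0 mul1r.
by rewrite telescope_sumr // addrC subrK.
Qed.

End Schedule.

Section Telescope.
Local Open Scope ring_scope.
Variables (R : realType) (V : choiceType) (K : simplicial_complex V).
Variables (f : nat -> V -> V) (c : V).
Hypothesis Kc : simplex K [set c].
Hypothesis f0 : forall v, f 0%N v = c.
Hypothesis f_contiguous : forall S j, simplex K S ->
  simplex K (f j @` S `|` f j.+1 @` S).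
Hypothesis f_stationary : forall S v, simplex K S -> S v ->
  exists N, forall j, (N <= j)%N -> f j v = v.

Definition telescope_kernel (t : R) (v : V) : V -> R :=
  if t <= 0 then dirac_at R id v
  else interp (progress (stage t) t)
    (dirac_at R (f (stage t)) v) (dirac_at R (f (stage t).+1) v).

Definition telescope_homotopy (p : R * realization R K) : realization R K :=
  point_of p.2 (mix p.2 (telescope_kernel p.1)).

Lemma prob_telescope_kernel t v : prob (telescope_kernel t v).
Proof.
rewrite /telescope_kernel; case: ifP => _; first exact: prob_dirac.
by apply: prob_interp; [exact: progress_itv|exact: prob_dirac|exact: prob_dirac].
Qed.

Lemma supp_telescope_kernel t v : 0 < t ->
  supp (telescope_kernel t v) `<=` [set f (stage t) v; f (stage t).+1 v].
Proof.
move=> t0; rewrite /telescope_kernel leNgt t0 /=.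
by move=> u us; have := supp_interp us; rewrite !supp_dirac.
Qed.

Lemma simplex_telescope t (x : realization R K) :
  simplex K (supp (mix x (telescope_kernel t))).
Proof.
have px := bary_prob x.
have pk v := prob_telescope_kernel t v.
have pm := prob_mix px (fun v _ => pk v).
have [t0|t0] := leP t 0.
  rewrite supp_mix // /telescope_kernel t0.
  suff -> : \bigcup_(v in supp x) supp (dirac_at R id v) = supp x.
    exact: supp_simplex.
  apply/seteqP; split=> v; first by case=> u xu; rewrite supp_dirac => ->.
  by move=> xv; exists v => //; rewrite supp_dirac.
apply: (simplex_face (f_contiguous (stage t) (supp_simplex x))).
  rewrite supp_mix // => u [v xv] /(supp_telescope_kernel t0).
  by move=> [->|->]; [left|right]; exists v.
exact: prob_neq0.
Qed.

Lemma telescope_homotopyE t x :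
  bary (telescope_homotopy (t, x)) = mix x (telescope_kernel t).
Proof.
apply: point_ofE; last exact: simplex_telescope.
apply: prob_mix => [|v _]; [exact: bary_prob|exact: prob_telescope_kernel].
Qed.

Lemma telescope_kernelE t v u N : 0 <= t <= 1 ->
  (forall j, (N <= j)%N -> f j v = v) ->
  telescope_kernel t v u = (f 0%N v == u)%:R +
    \sum_(0 <= j < N) progress j t * ((f j.+1 v == u)%:R - (f j v == u)%:R).
Proof.
move=> /andP[t0 t1] fN; pose g j : R := (f j v == u)%:R.
have gN j : (N <= j)%N -> g j = g N by move=> Nj; rewrite /g !fN.
rewrite -[LHS]/(_ : R) /telescope_kernel; case: ifPn => [t0'|].
  have -> : t = 0 by apply/eqP; rewrite eq_le t0' t0.
  by rewrite (sum_progress0 g) /g /dirac_at fN.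
rewrite -ltNge => tp; rewrite (@sum_progress _ g N t) ?tp //.
Qed.

Lemma stationary_simplex S : simplex K S ->
  exists N, forall v j, S v -> (N <= j)%N -> f j v = v.
Proof.
move=> KS; have fS := simplex_finite KS.
have /choice[N HN] : forall v, exists N, S v -> forall j, (N <= j)%N -> f j v = v.
  move=> v; have [Sv|nSv] := pselect (S v); last by exists 0%N.
  by have [N HN] := f_stationary KS Sv; exists N.
exists (\max_(v <- fset_set S) N v)%N => v j Sv Nj; apply: HN => //.
by apply: leq_trans Nj; apply: leq_bigmax_seq => //; rewrite in_fset_set // inE.
Qed.

Lemma continuous_telescope_homotopy :
  {within @unit_itv R `*` [set: realization R K], continuous telescope_homotopy}.
Proof.
apply: continuous_homotopy => [S KS|S t x u KS It Sx].
  have [N HN] := stationary_simplex KS; have fS := simplex_finite KS.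
  exists (\bigcup_(j in `I_N.+1) f j @` S).
    by apply: bigcup_finite => // j _; exact: finite_image.
  move=> t y It Sy u; rewrite telescope_homotopyE => yu.
  have : supp (mix y (telescope_kernel t)) u by [].
  rewrite supp_mix; [|exact: bary_prob|by move=> v _; exact: prob_telescope_kernel].
  case=> v /Sy Sv ku.
  suff [j <-] : exists j, f j v = u.
    have [jN|Nj] := leqP j N; first by exists j => //; exists v.
    by exists N => //=; exists v => //; rewrite !HN // ltnW.
  move: ku; have [t0|t0] := leP t 0; last first.
    by move=> /(supp_telescope_kernel t0)[->|->]; eexists.
  rewrite /telescope_kernel t0 supp_dirac => ->.
  by exists N; rewrite HN.
have [N HN] := stationary_simplex KS; have fS := simplex_finite KS.
(* In this form the kernel is affine in the continuous functions
   [progress j], with the same [N] for all vertices of [S]. *)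
pose k s v := (f 0%N v == u)%:R +
    \sum_(0 <= j < N) progress j s * ((f j.+1 v == u)%:R - (f j v == u)%:R) : R.
have E s y : @unit_itv R s -> closed_simplex S y ->
    telescope_homotopy (s, y) u = \sum_(v <- fset_set S) y v * k s v.
  rewrite /unit_itv /= in_itv /= => Is Sy.
  rewrite telescope_homotopyE /mix (sum_supp (telescope_kernel s ^~ u) fS) //.
  rewrite big_seq [RHS]big_seq; apply: eq_bigr => v; rewrite in_fset_set // inE.
  by move=> Sv; congr (_ * _); apply: telescope_kernelE => // j; exact: HN.
rewrite E //; set FF := filter_prod _ _.
apply: (@cvg_trans _ ((fun p : R * realization R K =>
    \sum_(v <- fset_set S) p.2 v * k p.1 v) @ FF)).
  apply: near_eq_cvg; exists (@unit_itv R, closed_simplex S).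
    by split; [exact: withinT|exact: coord_nbhs_closed].
  by move=> [s y] [/= Is Sy]; rewrite E.
apply: cvg_big => [|v _]; first exact: add_continuous.
apply: cvgM.
  apply: (cvg_comp snd (fun y : realization R K => y v)); first exact: cvg_snd.
  exact: cvg_coord.
apply: (cvg_comp fst (k^~ v)); first exact: cvg_fst.
apply: (@cvg_trans _ ((k ^~ v) @ nbhs t)).
  by apply: cvg_app; exact: cvg_within.
apply: cvgD; first exact: cvg_cst.
apply: cvg_big => [|j _]; first exact: add_continuous.
by apply: cvgM; [exact: continuous_progress|exact: cvg_cst].
Qed.

(** At time 0 nothing has moved, and the homotopies take place in decreasing
    order of their indices, so that a point is affected only by the finitely
    many of them that move its vertices. *)
Lemma contractible_telescope : contractible R (realization R K).
Proof.
have Kd : simplex K (supp (dirac_at R id c)) by rewrite supp_dirac.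
have [d0 _ d1] := prob_dirac R id c.
pose x0 : realization R K := Realization d0 Kd d1.
exists x0, telescope_homotopy; split=> [|x|x].
- exact: continuous_telescope_homotopy.
- apply: bary_inj; rewrite telescope_homotopyE /telescope_kernel lexx.
  exact: mix_id (bary_prob x).
- apply: bary_inj; rewrite telescope_homotopyE /telescope_kernel.
  rewrite leNgt ltr01 /= progress_stage1 stage1.
  apply/funext => u; rewrite /mix.
  have [_ fx x1] := bary_prob x.
  rewrite (sum_supp (fun v => interp 0 _ _ u) fx) // -[RHS]mul1r -x1 (sum_supp1 fx) //.
  rewrite mulr_suml; apply: eq_bigr => v _; congr (_ * _).
  by rewrite /interp subr0 mul1r mul0r addr0 /dirac_at f0.
Qed.

End Telescope.

(** * Homotopy domination *)

Section Domination.
Local Open Scope ring_scope.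

Lemma within_continuous_comp (A B C : topologicalType) (D : set A) (D' : set B)
    (phi : A -> B) (psi : B -> C) :
  {within D, continuous phi} -> (forall x, D x -> D' (phi x)) ->
  {within D', continuous psi} -> {within D, continuous (psi \o phi)}.
Proof.
move=> /subspace_continuousP cphi DD' /subspace_continuousP cpsi.
apply/subspace_continuousP => x Dx U /(cpsi _ (DD' _ Dx)) /=.
rewrite /within /= => /(cphi x Dx); rewrite /nbhs /= /within /=.
by apply: filterS => y H Dy; apply: (H Dy); exact: DD'.
Qed.

Variables (R : realType) (A B : topologicalType) (i : A -> B) (r : B -> A).

(** Follow the homotopy [H] from the identity to [r \o i], then the contraction
    of [B] seen through [i] and [r]. *)
Lemma contractible_dominated (H : R * A -> A) :
  continuous i -> continuous r ->
  {within `[0, 1] `*` [set: A], continuous H} ->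
  (forall x, H (0, x) = x) -> (forall x, H (1, x) = r (i x)) ->
  contractible R B -> contractible R A.
Proof.
move=> ci cr cH H0 H1 [y0 [F [cF F0 F1]]].
pose left_half := `[0, 2^-1]%classic `*` [set: A] : set (R * A).
pose right_half := `[2^-1, 1]%classic `*` [set: A] : set (R * A).
pose E1 := H \o (fun p : R * A => (2 * p.1, p.2)).
pose E2 := (r \o F) \o (fun p : R * A => (2 * p.1 - 1, i p.2)).
pose E p := if p.1 <= 2^-1 then E1 p else E2 p.
have cdbl : continuous (fun p : R * A => 2 * p.1).
  by move=> p; apply: cvgM; [exact: cvg_cst|exact: cvg_fst].
have cE1 : {within left_half, continuous E1}.
  apply: within_continuous_comp cH.
    apply: continuous_subspaceT => p.
    by apply: (cvg_pair (f := fun q : R * A => 2 * q.1) (cdbl p)); exact: cvg_snd.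
  move=> [t x] [/=]; rewrite !in_itv /= => /andP[a b] _; split=> //=.
  by apply/andP; split; lra.
have cE2 : {within right_half, continuous E2}.
  apply: (@within_continuous_comp _ (R * B)%type _ _
    (`[(0 : R), (1 : R)]%classic `*` [set: B])).
  - apply: continuous_subspaceT => p.
    have c1 : 2 * q.1 - 1 @[q --> p] --> 2 * p.1 - 1.
      by apply: cvgB; [exact: cdbl|exact: cvg_cst].
    have c2 : i q.2 @[q --> p] --> i p.2.
      by apply: (cvg_comp snd i); [exact: cvg_snd|exact: ci].
    exact: (cvg_pair c1 c2).
  - move=> [t x] [/=]; rewrite !in_itv /= => /andP[a b] _; split=> //=.
    by apply/andP; split; lra.
  - apply: (@within_continuous_comp _ _ _ _ setT _ r) => //.
    exact: continuous_subspaceT.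
have closed_half a b : closed (`[a, b]%classic `*` [set: A] : set (R * A)).
  rewrite (_ : _ `*` _ = fst @^-1` `[a, b]%classic); last first.
    by apply/seteqP; split=> [p [] //|p ab]; split.
  have /continuous_closedP : continuous (@fst R A) by move=> p; exact: cvg_fst.
  by apply; exact: interval_closed.
exists (r y0), E; split=> [|x|x].
- have -> : `[0, 1]%classic `*` [set: A] = left_half `|` right_half.
    apply/seteqP; split=> [[t x] [/=]|[t x]]; rewrite /left_half /right_half /=.
      rewrite !in_itv /= => /andP[a b] _; have [c|c] := leP t 2^-1.
        by left; rewrite a.
      by right; rewrite ltW // b.
    by rewrite !in_itv /= => -[|] [/andP[a b] _]; split=> //; apply/andP; split; lra.
  apply: withinU_continuous; [exact: closed_half|exact: closed_half| |].
    apply: subspace_eq_continuous cE1 => -[t x] /set_mem.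
    rewrite /left_half /= in_itv /= => -[/andP[a b] _].
    by rewrite /from_subspace /E /= b.
  apply: subspace_eq_continuous cE2 => -[t x] /set_mem.
  rewrite /right_half /from_subspace /E /= in_itv /= => -[/andP[a b] _].
  case: ifPn => // c.
  have -> : t = 2^-1 by apply/eqP; rewrite eq_le a c.
  by rewrite /E1 /E2 /= mulfV // subrr F0 H1.
- by rewrite /E /= invr_ge0 ler0n /E1 /= mulr0 H0.
- rewrite /E /= /E2 /= ifF; last by apply/negbTE; rewrite -ltNge; lra.
  by rewrite (_ : 2 * 1 - 1 = 1 :> R) ?F1 //; lra.
Qed.

End Domination.

(** * Barycentric subdivision and subcomplexes *)

Section LevelWeights.
Local Open Scope ring_scope.
Variables (R : realType) (V : choiceType).
Implicit Types (c : V -> R) (s : {fset V}).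

Lemma prob_sum_le1 c s : prob c -> \sum_(v <- s) c v <= 1.
Proof.
case=> c0 fc <-.
have fU : finite_set ([set` s] `|` supp c) by rewrite finite_setU.
rewrite (sum_supp1 fU); last by move=> v; right.
rewrite [leRHS](bigID (mem s)) /= -[leLHS]addr0 lerD //; last exact: sumr_ge0.
rewrite -[leRHS]big_filter le_eqVlt; apply/orP; left; apply/eqP/perm_big.
apply: uniq_perm; [exact: fset_uniq|by rewrite filter_uniq ?fset_uniq|].
move=> v; rewrite mem_filter /=; case: (boolP (v \in s)) => //= vs.
suff -> : v \in fset_set ([set` s] `|` supp c) by [].
by rewrite in_fset_set // inE; left.
Qed.

(** For a weight [c], a set [s] has positive [level_weight] only if every
    weight in [s] exceeds the total weight outside [s]: the product is at most
    each of its factors, and 1 minus the sum is the weight outside.  These [s]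
    are then strict superlevel sets of [c], hence form a chain, as do the faces
    in the barycentric subdivision.  The expression depends only on the
    coordinates in [s], so its continuity is plain. *)
Definition level_weight c s : R :=
  Num.max 0 (\prod_(v <- s) c v + \sum_(v <- s) c v - 1).

Lemma level_weight_ge0 c s : 0 <= level_weight c s.
Proof. by rewrite le_max lexx. Qed.

Lemma level_weight_pos c s : level_weight c s != 0 ->
  1 < \prod_(v <- s) c v + \sum_(v <- s) c v.
Proof.
rewrite /level_weight => nz; rewrite ltNge; apply/negP => le1.
by move/eqP: nz; apply; apply/max_idPl; rewrite subr_le0.
Qed.

Lemma level_weight_lt c s u v : prob c -> level_weight c s != 0 ->
  v \in s -> u \notin s -> c u < c v.
Proof.
move=> pc /level_weight_pos pos vs us; have [c0 _ _] := pc.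
have le_v : \prod_(v <- s) c v <= c v.
  rewrite (big_fsetD1 v) //= ler_piMr // prodr_ile1 // => w _.
  by rewrite c0 prob_le1.
have := prob_sum_le1 (u |` s)%fset pc; rewrite big_fsetU1 //= => le1.
lra.
Qed.

Lemma level_weight_sub c s v : prob c -> level_weight c s != 0 ->
  v \in s -> supp c v.
Proof.
move=> pc /level_weight_pos pos vs; apply/negP => /eqP cv0.
have := prob_sum_le1 s pc; move: pos.
by rewrite (big_fsetD1 v) //= cv0 mul0r; lra.
Qed.

Lemma level_weight_neq0 c s : level_weight c s != 0 -> s != fset0.
Proof.
move=> /level_weight_pos; apply: contraTneq => ->.
by rewrite !big_seq_fset0 addr0 ltxx.
Qed.

Lemma level_weight_nested c s s' : prob c ->
  level_weight c s != 0 -> level_weight c s' != 0 ->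
  (s `<=` s' \/ s' `<=` s)%fset.
Proof.
move=> pc ws ws'; have [ss'|nss'] := boolP (s `<=` s')%fset; [by left|right].
have /fsubsetPn[v vs vs'] := nss'; apply/fsubsetP => u us'.
apply/negPn/negP => us.
have := lt_trans (level_weight_lt pc ws vs us) (level_weight_lt pc ws' us' vs').
by rewrite ltxx.
Qed.

(** Some [level_weight] is positive, since nothing lies outside the support;
    hence these weights can be normalized. *)
Lemma level_weight_supp c : prob c -> level_weight c (fset_set (supp c)) != 0.
Proof.
move=> pc; have [c0 fc c1] := pc; rewrite gt_eqF // lt_max; apply/orP; right.
rewrite -(sum_supp1 fc) // c1 addrK big_seq prodr_gt0 // => v.
by rewrite in_fset_set // => /set_mem cv; rewrite lt_def c0 andbT.
Qed.

(** A continuous substitute for the barycentric coordinates of [c] in the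
    barycentric subdivision. *)
Definition subdivision c s : R :=
  level_weight c s / \sum_(s \in [set: {fset V}]) level_weight c s.

Lemma supp_level_weight c S : prob c -> finite_set S -> supp c `<=` S ->
  supp (level_weight c) `<=` [set` fpowerset (fset_set S)].
Proof.
move=> pc fS cS s ws; rewrite /= fpowersetE; apply/fsubsetP => v vs.
by rewrite in_fset_set // inE; apply/cS/(level_weight_sub pc ws).
Qed.

Lemma sum_level_weight_gt0 c : prob c ->
  0 < \sum_(s \in [set: {fset V}]) level_weight c s.
Proof.
move=> pc; have [_ fc _] := pc.
rewrite (sum_supp1 (finite_fset _) (supp_level_weight pc fc _)) //.
rewrite set_fsetK (big_fsetD1 (fset_set (supp c))) /=.
  rewrite ltr_pwDl ?sumr_ge0 ?lt_def ?level_weight_supp ?level_weight_ge0 //.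
  by move=> s _; exact: level_weight_ge0.
by rewrite fpowersetE.
Qed.

Lemma supp_subdivision c : prob c -> supp (subdivision c) = supp (level_weight c).
Proof.
move=> pc; apply/seteqP; split=> s; rewrite /supp /subdivision /= mulf_eq0 negb_or.
  by case/andP.
by move=> ->; rewrite invr_eq0 gt_eqF // sum_level_weight_gt0.
Qed.

Lemma prob_subdivision c : prob c -> prob (subdivision c).
Proof.
move=> pc; have [_ fc _] := pc; have pos := sum_level_weight_gt0 pc.
have sub := supp_level_weight pc fc (@subset_refl _ _).
have fF := finite_fset (fpowerset (fset_set (supp c))).
split.
- by move=> s; rewrite divr_ge0 ?level_weight_ge0 // ltW.
- by rewrite supp_subdivision //; exact: sub_finite_set fF.
- rewrite (sum_supp1 fF) ?supp_subdivision // -mulr_suml -(sum_supp1 fF) //.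
  by rewrite mulfV // gt_eqF.
Qed.

End LevelWeights.

Section SubdivisionMap.
Local Open Scope ring_scope.
Variables (R : realType) (V V' : choiceType).
Variables (K : simplicial_complex V) (K' : simplicial_complex V').
Variables (g : {fset V} -> V') (y0 : realization R K').
Hypothesis Kg : forall C : set {fset V}, finite_set C -> C !=set0 ->
  (forall s, C s -> simplex K [set` s]) ->
  (forall s s', C s -> C s' -> (s `<=` s' \/ s' `<=` s)%fset) ->
  simplex K' (g @` C).

(** The map induced on realizations by a map [g] that takes the simplices of
    [K] to vertices of [K'] and chains of simplices to simplices. *)
Definition subdivision_map (x : realization R K) : realization R K' :=
  point_of y0 (mix (subdivision x) (dirac_at R g)).

Lemma supp_subdivision_map (x : realization R K) :
  supp (mix (subdivision x) (dirac_at R g)) = g @` supp (level_weight x).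
Proof.
have px := bary_prob x.
rewrite supp_mix; [|exact: prob_subdivision|by move=> s _; exact: prob_dirac].
rewrite supp_subdivision //; apply/seteqP; split=> u.
  by case=> s ws; rewrite supp_dirac => ->; exists s.
by case=> s ws <-; exists s => //; rewrite supp_dirac.
Qed.

Lemma subdivision_mapE (x : realization R K) :
  bary (subdivision_map x) = mix (subdivision x) (dirac_at R g).
Proof.
have px := bary_prob x; have psx := prob_subdivision px.
have ws_sub := supp_level_weight px (simplex_finite (supp_simplex x)) (@subset_refl _ _).
apply: point_ofE.
  by apply: prob_mix => [//|s _]; exact: prob_dirac.
rewrite supp_subdivision_map; apply: Kg => [| |s ws|s s' ws ws'].
- exact: sub_finite_set ws_sub (finite_fset _).
- by rewrite -supp_subdivision //; exact: prob_neq0.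
- apply: simplex_face (supp_simplex x) _ _.
    by move=> v; exact: (level_weight_sub px ws).
  by have /fset0Pn[v vs] := level_weight_neq0 ws; exists v.
- exact: level_weight_nested px ws ws'.
Qed.

Lemma cvg_subdivision_map S (x : realization R K) u :
  simplex K S -> closed_simplex S x ->
  (fun y : realization R K => subdivision_map y u) @ coord_nbhs S x -->
    subdivision_map x u.
Proof.
move=> KS Sx; have fS := simplex_finite KS.
pose F := fpowerset (fset_set S).
have E y : closed_simplex S y -> subdivision_map y u =
    \sum_(s <- F) level_weight y s / (\sum_(s <- F) level_weight y s)
      * dirac_at R g s u.
  move=> Sy; have py := bary_prob y.
  have sub := supp_level_weight py fS Sy.
  rewrite subdivision_mapE /mix (sum_supp (fun s => _) (finite_fset F)); last first.
    by rewrite supp_subdivision.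
  by rewrite set_fsetK /subdivision (sum_supp1 (finite_fset F)) // set_fsetK.
rewrite E //.
apply: (@cvg_trans _ ((fun y : realization R K =>
    \sum_(s <- F) level_weight y s / (\sum_(s <- F) level_weight y s)
      * dirac_at R g s u) @ coord_nbhs S x)).
  by apply: near_eq_cvg; exists 1 => // y Sy _; rewrite E.
have cw s : (fun y : realization R K => level_weight y s) @ coord_nbhs S x -->
    level_weight x s.
  rewrite /level_weight.
  apply: (cvg_comp (fun y : realization R K =>
    \prod_(v <- s) y v + \sum_(v <- s) y v - 1) (fun z : R => Num.max 0 z)).
    apply: cvgB; last exact: cvg_cst.
    apply: cvgD; (apply: cvg_big => [|v _]; last exact: cvg_coord).
      exact: mul_continuous.
    exact: add_continuous.
  apply: (@continuous_max _ _ (fun=> 0) id); first exact: cvg_cst.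
  exact: cvg_id.
apply: cvg_big => [|s _]; first exact: add_continuous.
apply: cvgM; last exact: cvg_cst.
apply: cvgM; first exact: cw.
apply: cvgV.
  rewrite gt_eqF // -[F]set_fsetK -(sum_supp1 (finite_fset F)).
    exact/sum_level_weight_gt0/bary_prob.
  exact: supp_level_weight (bary_prob x) fS Sx.
by apply: cvg_big => [|s' _]; [exact: add_continuous|exact: cw].
Qed.

Lemma continuous_subdivision_map : continuous subdivision_map.
Proof.
apply: continuous_realization => [S KS|S x v KS Sx]; last exact: cvg_subdivision_map.
have fS := simplex_finite KS.
exists (g @` [set` fpowerset (fset_set S)]); first exact: finite_image.
move=> y Sy u; rewrite subdivision_mapE => yu.
have : supp (mix (subdivision y) (dirac_at R g)) u by [].
rewrite supp_subdivision_map => -[s ws <-]; exists s => //.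
exact: (supp_level_weight (bary_prob y) fS Sy).
Qed.

End SubdivisionMap.

Section Subcomplex.
Local Open Scope ring_scope.
Variables (R : realType) (V : choiceType) (K K' : simplicial_complex V).
Variable g : {fset V} -> V.
Hypothesis K'K : forall S, simplex K' S -> simplex K S.
Hypothesis Kg : forall C : set {fset V}, finite_set C -> C !=set0 ->
  (forall s, C s -> simplex K [set` s]) ->
  (forall s s', C s -> C s' -> (s `<=` s' \/ s' `<=` s)%fset) ->
  simplex K' (g @` C).
Hypothesis g_in : forall s : {fset V}, simplex K' [set` s] -> g s \in s.

Definition inclusion (x : realization R K') : realization R K :=
  Realization (@bary_ge0 _ _ _ x) (K'K (supp_simplex x)) (bary_sum x).

Lemma continuous_inclusion : continuous inclusion.
Proof.
apply: continuous_realization => [S KS|S x v KS Sx].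
  by exists S; [exact: simplex_finite KS|].
exact: cvg_coord.
Qed.

(** If [g] selects a vertex of every simplex of [K'], then for [x] in [K'] the
    subdivision map keeps [x] inside its own closed simplex, so that straight
    lines join the identity of [K'] to the composite of inclusion and
    subdivision map. *)
Lemma contractible_subcomplex :
  contractible R (realization R K) -> contractible R (realization R K').
Proof.
move=> cK; have [x0 _] := cK.
have y0 : realization R K'.
  pose s := fset_set (supp x0); have fx := simplex_finite (supp_simplex x0).
  have K's : simplex K' [set g s].
    rewrite -(image_set1 g s); apply: Kg => [|| _ ->| _ _ -> ->].
    - exact: finite_set1.
    - by exists s.
    - by rewrite fset_setK //; exact: supp_simplex.
    - by left.
  have [d0 _ d1] := prob_dirac R id (g s).
  by apply: (Realization d0 _ d1); move: K's; rewrite -[[set g s]](supp_dirac R id).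
pose r := subdivision_map (K := K) (K' := K') g y0.
pose H p : realization R K' :=
  point_of p.2 (interp p.1 (p.2 : realization R K') (r (inclusion p.2))).
have supp_r (x : realization R K') : supp (r (inclusion x)) `<=` supp x.
  rewrite subdivision_mapE // supp_subdivision_map => _ [s ws <-].
  have sub v : v \in s -> supp x v by exact: (level_weight_sub (bary_prob x) ws).
  apply: (sub); apply: g_in; apply: simplex_face (supp_simplex x) (sub) _.
  by have /fset0Pn[v vs] := level_weight_neq0 ws; exists v.
have HE t x : @unit_itv R t -> bary (H (t, x)) = interp t x (r (inclusion x)).
  rewrite /unit_itv /= in_itv /= => It.
  have pH := prob_interp It (bary_prob x) (bary_prob (r (inclusion x))).
  apply: point_ofE => //; apply: simplex_face (supp_simplex x) _ (prob_neq0 pH).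
  by move=> v Hv; have [//|] := supp_interp Hv; exact: supp_r.
have I0 : @unit_itv R 0 by rewrite /unit_itv /= in_itv /= lexx ler01.
have I1 : @unit_itv R 1 by rewrite /unit_itv /= in_itv /= lexx ler01.
apply: (@contractible_dominated _ _ _ inclusion r H) => //.
- exact: continuous_inclusion.
- exact: continuous_subdivision_map.
- apply: continuous_homotopy => [S KS|S t x v KS It Sx].
    exists S; first exact: simplex_finite KS.
    move=> t y It Sy v; rewrite HE // => Hv.
    have {}Hv : supp (interp t y (r (inclusion y))) v by [].
    by have [|/supp_r] := supp_interp Hv; exact: Sy.
  rewrite HE //; set FF := filter_prod _ _.
  apply: (@cvg_trans _ ((fun p : R * realization R K' =>
      interp p.1 p.2 (r (inclusion p.2)) v) @ FF)).
    apply: near_eq_cvg; exists (@unit_itv R, closed_simplex S).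
      by split; [exact: withinT|exact: coord_nbhs_closed].
    by move=> [s y] [/= Is Sy]; rewrite HE.
  have cfst : (fun p : R * realization R K' => p.1) @ FF --> t.
    by apply: cvg_trans (cvg_within _); exact: cvg_fst.
  have csnd (h : realization R K' -> R) : h @ coord_nbhs S x --> h x ->
      (fun p : R * realization R K' => h p.2) @ FF --> h x.
    by move=> ch; apply: (cvg_comp snd h) ch; exact: cvg_snd.
  apply: cvgD; apply: cvgM.
  - by apply: cvgB => //; exact: cvg_cst.
  - by apply: (csnd (fun y => y v)); exact: cvg_coord.
  - exact: cfst.
  - apply: (csnd (fun y => r (inclusion y) v)).
    have KS' := K'K KS.
    have := @cvg_subdivision_map R V V K K' g y0 Kg S (inclusion x) v KS' Sx.
    apply: cvg_trans => U [e e0 eU]; exists e => // y Sy xy.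
    exact: (eU (inclusion y)).
- move=> x; apply: bary_inj; rewrite HE //; apply/funext => v.
  by rewrite /interp subr0 mul1r mul0r addr0.
- move=> x; apply: bary_inj; rewrite HE //; apply/funext => v.
  by rewrite /interp subrr mul0r add0r mul1r.
Qed.

End Subcomplex.

(** * Subgroups of finite index *)

Section FiniteIndex.
Local Open Scope group_scope.
Variable G : groupType.
Implicit Types (H K L : set G) (x y g : G).

Lemma subgroupP K : subgroup K <->
  [/\ K 1, forall x y, K x -> K y -> K (x * y) & forall x, K x -> K x^-1].
Proof.
split=> [sK|[K1 KM KV]].
  split; first by have [/set_mem] := sK.
  - by move=> x y /mem_set Kx /mem_set Ky; apply/set_mem/(group_closedM sK).
  - by move=> x /mem_set Kx; apply/set_mem/(group_closedV sK).
split; first exact/mem_set.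
by move=> x y /set_mem Kx /set_mem Ky; apply/mem_set/KM/KV.
Qed.

Lemma subgroup1 K : subgroup K -> K 1.
Proof. by case/subgroupP. Qed.
Lemma subgroupM K x y : subgroup K -> K x -> K y -> K (x * y).
Proof. by case/subgroupP => _ + _ => /[apply]/[apply]. Qed.
Lemma subgroupV K x : subgroup K -> K x -> K x^-1.
Proof. by case/subgroupP => _ _ /[apply]. Qed.
Lemma subgroupF K x y : subgroup K -> K x -> K y -> K (x / y).
Proof. by move=> sK Kx Ky; apply: subgroupM => //; exact: subgroupV. Qed.

Lemma subgroupI H K : subgroup H -> subgroup K -> subgroup (H `&` K).
Proof.
move=> sH sK; apply/subgroupP; split.
- by split; exact: subgroup1.
- by move=> x y [Hx Kx] [Hy Ky]; split; exact: subgroupM.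
- by move=> x [Hx Kx]; split; exact: subgroupV.
Qed.

Lemma right_cosetE K g x : right_coset K g x <-> K (x / g).
Proof.
split=> [[k Kk <-]|Kx]; first by rewrite mulgK.
by exists (x / g) => //; rewrite mulgVK.
Qed.

Lemma right_coset_eq K g x : subgroup K -> K (x / g) ->
  right_coset K x = right_coset K g.
Proof.
move=> sK Kxg; apply/seteqP; split=> y /right_cosetE Ky; apply/right_cosetE.
  by rewrite -(divgKA x); exact: subgroupM.
by rewrite -(divgKA g) -[g * _]invgF; apply: subgroupM => //; exact: subgroupV.
Qed.

(** Finite index phrased with representatives, which compose along towers and
    intersections more easily than sets of cosets. *)
Definition coset_reps H K : Prop :=
  exists s : seq G, forall x, H x -> exists2 g, g \in s & K (x / g).

Lemma coset_repsP H K : subgroup K -> finite_index H K <-> coset_reps H K.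
Proof.
move=> sK; split=> [fHK|[s Hs]].
  exists [seq xget 1 C | C <- fset_set (right_cosets H [set K])] => x Hx.
  have Dx : right_cosets H [set K] (right_coset K x) by exists K, x.
  exists (xget 1 (right_coset K x)).
    by apply: map_f; rewrite in_fset_set // inE.
  have Kxx : right_coset K x x by apply/right_cosetE; rewrite mulgV; exact: subgroup1.
  have /right_cosetE := xgetPex 1 (ex_intro _ x Kxx).
  by move=> /(subgroupV sK); rewrite invgF.
apply: (@sub_finite_set _ _ (right_coset K @` [set` s])).
  move=> C [_ [x [-> Hx ->]]]; have [g gs Kxg] := Hs x Hx.
  by exists g => //; apply/esym/right_coset_eq.
exact/finite_image/finite_seq.
Qed.

Lemma coset_reps_sub H H' K K' :
  H' `<=` H -> K `<=` K' -> coset_reps H K -> coset_reps H' K'.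
Proof.
move=> H'H KK' [s Hs]; exists s => x /H'H/Hs[g gs Kxg].
by exists g => //; exact: KK'.
Qed.

Lemma coset_repsI H K K' : subgroup K -> subgroup K' ->
  coset_reps H K -> coset_reps H K' -> coset_reps H (K `&` K').
Proof.
move=> sK sK' [s Hs] [s' Hs'].
exists [seq xget 1 (right_coset K g `&` right_coset K' g') | g <- s, g' <- s'].
move=> x Hx; have [g gs Kx] := Hs x Hx; have [g' gs' K'x] := Hs' x Hx.
have xC : (right_coset K g `&` right_coset K' g') x.
  by split; apply/right_cosetE.
exists (xget 1 (right_coset K g `&` right_coset K' g')).
  exact: allpairs_f.
have [/right_cosetE Kz /right_cosetE K'z] := xgetPex 1 (ex_intro _ x xC).
set z := xget _ _ in Kz K'z *.
split; [rewrite -(divgKA g)|rewrite -(divgKA g')].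
  by rewrite -[_ * z^-1]invgF; apply: subgroupF.
by rewrite -[_ * z^-1]invgF; apply: subgroupF.
Qed.

Lemma coset_reps_trans H K L : coset_reps L H -> coset_reps H K -> coset_reps L K.
Proof.
move=> [s Hs] [s' Hs']; exists [seq g' * g | g' <- s', g <- s] => x Lx.
have [g gs Hxg] := Hs x Lx; have [g' gs' Kxg] := Hs' _ Hxg.
by exists (g' * g); [exact: allpairs_f|rewrite invgM mulgA].
Qed.

Lemma subgroup_big (I : eqType) (s : seq I) (F : I -> set G) :
  (forall i, i \in s -> subgroup (F i)) ->
  subgroup [set x | forall i, i \in s -> F i x].
Proof.
move=> sF; apply/subgroupP; split.
- by move=> i /sF; exact: subgroup1.
- by move=> x y Fx Fy i si; apply: subgroupM; [exact: sF|exact: Fx|exact: Fy].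
- by move=> x Fx i si; apply: subgroupV; [exact: sF|exact: Fx].
Qed.

Lemma coset_reps_big H (I : eqType) (s : seq I) (F : I -> set G) :
  (forall i, i \in s -> subgroup (F i)) ->
  (forall i, i \in s -> coset_reps H (F i)) ->
  coset_reps H [set x | forall i, i \in s -> F i x].
Proof.
elim: s => [|i s IHs] sF rF; first by exists [:: 1] => x _; exists 1;
  [rewrite inE|move=> i].
have si j : j \in s -> j \in i :: s by rewrite inE => ->; rewrite orbT.
have ii : i \in i :: s by rewrite mem_head.
have := coset_repsI (sF i ii) (subgroup_big (fun j js => sF j (si j js)))
  (rF i ii) (IHs (fun j js => sF j (si j js)) (fun j js => rF j (si j js))).
apply: coset_reps_sub => // x [Fi Fs] j.
by rewrite inE => /orP[/eqP -> //|]; exact: Fs.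
Qed.

(** Two of the first [size s + 1] powers of [x] lie in the same coset. *)
Lemma coset_reps_power K (s : seq G) x : subgroup K ->
  (forall y, exists2 g, g \in s & K (y / g)) ->
  exists2 m, (0 < m <= size s)%N & K (x ^+ m).
Proof.
move=> sK Hs.
have /choice[r Hr] y : exists g, g \in s /\ K (y / g) by have [g] := Hs y; exists g.
pose f (i : 'I_(size s).+1) := r (x ^+ i).
have /injectivePn[i [j ij fij]] : ~~ injectiveb f.
  apply/negP => /injectiveP inj_f.
  have fs : {subset codom f <= s} by move=> _ /codomP[i ->]; have [] := Hr (x ^+ i).
  have uf : uniq (codom f) by rewrite map_inj_uniq ?enum_uniq.
  by have := uniq_leq_size uf fs; rewrite size_codom card_ord ltnn.
wlog lij : i j ij fij / (i < j)%N.
  move=> W; have [|ji|/val_inj ij'] := ltngtP i j.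
  - exact: W ij fij.
  - by apply: (W j i); rewrite // eq_sym.
  - by rewrite ij' eqxx in ij.
exists (j - i)%N; first by have := ltn_ord j; lia.
rewrite expgnFr ?(ltnW lij) // -(divgKA (r (x ^+ j))).
have [_ Ki] := Hr (x ^+ i); have [_ Kj] := Hr (x ^+ j).
apply: subgroupM => //; rewrite -[r (x ^+ j) * _]invgF.
by apply: subgroupV => //; rewrite -/(f j) -fij.
Qed.

End FiniteIndex.

(** * Countability of the set of finite index subgroups *)

Section Automata.
Local Open Scope group_scope.
Variables (X : finType) (G : groupType) (gen : X -> G).
Hypothesis gen_surj : range (freegroup_eval gen) = [set: G].

(** A deterministic automaton: its transitions and its accepting states, the
    initial state being 0.  It is a countable type because [X] is finite. *)
Definition automaton : countType :=
  {n : nat & ({ffun 'I_n.+1 * (X * bool) -> 'I_n.+1} * {set 'I_n.+1})%type}.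

Definition automaton_run (A : automaton) (u : seq (letter X)) : 'I_(tag A).+1 :=
  foldl (fun i a => (tagged A).1 (i, a)) ord0 u.

Definition automaton_subset (A : automaton) : set G :=
  [set x | exists u : freegroup X,
     freegroup_eval gen u = x /\ automaton_run A u \in (tagged A).2].

(** Reading a word while remembering only the coset of its value is a finite
    computation, because the cosets [K * g] are permuted by right
    multiplication by letters. *)
Lemma finite_index_automaton K : subgroup K -> coset_reps [set: G] K ->
  exists A, automaton_subset A = K.
Proof.
move=> sK [s Hs]; pose n := size s.
(* The representative 1 is put in front so that the initial state 0 is the
   coset [K]. *)
pose t i := nth 1 (1 :: s) i.
have /choice[d Hd] : forall p : 'I_n.+1 * (X * bool),
    exists j : 'I_n.+1, K (t p.1 * letter_eval gen p.2 / t j).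
  move=> p; have [g gs Kg] := Hs (t p.1 * letter_eval gen p.2) I.
  have ij : (index g (1%g :: s) < n.+1)%N.
    by rewrite -[n.+1]/(size (1%g :: s)) index_mem inE gs orbT.
  by exists (Ordinal ij); rewrite /t /= nth_index // inE gs orbT.
pose A : automaton :=
  existT _ n ([ffun p => d p], [set j : 'I_n.+1 | `[< K (t j) >]]%SET).
have runP (u : seq (letter X)) :
    K ((\prod_(a <- u) letter_eval gen a) / t (automaton_run A u)).
  elim/last_ind: u => [|u a IHu].
    by rewrite big_nil mul1g /t /= invg1; exact: subgroup1.
  rewrite big_rcons /= /automaton_run foldl_rcons -/(automaton_run A u) ffunE.
  set i := automaton_run A u in IHu *.
  have := subgroupM sK IHu (Hd (i, a)); rewrite /= -!mulgA.
  by rewrite mulKg.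
exists A; apply/seteqP; split=> x.
  case=> u [<-]; rewrite /= inE => /asboolP Kt.
  rewrite -[freegroup_eval _ _](mulgVK (t (automaton_run A u))).
  exact: subgroupM sK (runP u) Kt.
move=> Kx; have : range (freegroup_eval gen) x by rewrite gen_surj.
case=> u _ ux; exists u; split=> //; rewrite /= inE; apply/asboolP.
have := subgroupM sK (subgroupV sK (runP u)) Kx.
by rewrite invgF -ux /freegroup_eval mulgVK.
Qed.

Lemma countable_finite_index : exists e : nat -> set G,
  forall K, subgroup K -> coset_reps [set: G] K -> exists n, e n = K.
Proof.
exists (fun n => if @choice.unpickle automaton n is Some A
  then automaton_subset A else setT).
move=> K sK rK; have [A AK] := finite_index_automaton sK rK.
by exists (choice.pickle A); rewrite choice.pickleK.
Qed.

End Automata.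

(** * The action on a regular graph *)

Section RegularGraph.
Local Open Scope group_scope.
Variables (X : choiceType) (Gamma : xgraph X).
Hypothesis regular : xregular Gamma.
Implicit Types (v : vertex Gamma) (a : letter X) (u s : seq (letter X)).

Lemma regular_edge v a : exists e : hedge Gamma, horigin e = v /\ hlabel e = a.
Proof. by have [e [He _]] := regular v a; exists e. Qed.

Definition out_edge v a : hedge Gamma := sval (cid (regular_edge v a)).

Lemma out_edge_origin v a : horigin (out_edge v a) = v.
Proof. by rewrite /out_edge; case: (cid _) => e []. Qed.
Lemma out_edge_label v a : hlabel (out_edge v a) = a.
Proof. by rewrite /out_edge; case: (cid _) => e []. Qed.
Lemma out_edge_unique v (e : hedge Gamma) :
  horigin e = v -> out_edge v (hlabel e) = e.
Proof.
move=> ev; have [e' [_ U]] := regular v (hlabel e).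
transitivity e'; last exact: U.
by apply/esym/U; split; [exact: out_edge_origin|exact: out_edge_label].
Qed.

Definition step v a : vertex Gamma := hterminus (out_edge v a).
Definition walk v u : vertex Gamma := foldl step v u.

(** The formal inverse of the edge that was followed is the edge with inverse
    label, by uniqueness. *)
Lemma stepK v a : step (step v a) (letter_inv a) = v.
Proof.
have E : horigin (hedge_inv (out_edge v a)) = step v a.
  by rewrite /step /horigin /hterminus /=; case: (out_edge v a).2.
have -> : letter_inv a = hlabel (hedge_inv (out_edge v a)).
  by rewrite -{1}(out_edge_label v a).
rewrite {1}/step (out_edge_unique E) -[RHS](out_edge_origin v a).
by rewrite /hterminus /horigin /=; case: (out_edge v a).2.
Qed.

Lemma walk_cat v u s : walk v (reduced_cat u s) = walk (walk v u) s.
Proof.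
elim: u v => //= a u IHu v; rewrite -IHu.
case: (reduced_cat u s) => [//|b t] /=; case: eqP => [-> /=|//].
by rewrite stepK.
Qed.

Lemma walkM v (x y : freegroup X) : walk v (x * y)%g = walk (walk v x) y.
Proof. exact: walk_cat. Qed.

Lemma walkVK v (x : freegroup X) : walk (walk v x) (x^-1)%g = v.
Proof. by rewrite -walkM mulgV. Qed.

Lemma path_walk v (p : seq (hedge Gamma)) :
  path_from v p -> path_terminus v p = walk v (path_label p).
Proof.
elim: p v => //= e p IHp v [ev /IHp].
by rewrite /path_terminus /= => ->; rewrite /step (out_edge_unique ev).
Qed.

Fixpoint walk_path v u : seq (hedge Gamma) :=
  if u is a :: s then out_edge v a :: walk_path (step v a) s else [::].

Lemma walk_path_from v u : path_from v (walk_path v u).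
Proof. by elim: u v => //= a u IHu v; split; [exact: out_edge_origin|]. Qed.

Lemma walk_path_label v u : path_label (walk_path v u) = u.
Proof.
elim: u v => //= a u IHu v; rewrite /path_label /= out_edge_label.
by congr (_ :: _); exact: IHu.
Qed.

(** A backtracking in the path is visible as a cancellation in its label. *)
Lemma reduced_label_path (p : seq (hedge Gamma)) :
  freely_reduced (path_label p) -> reduced_path p.
Proof.
move=> red p1 e p2 E; move: red; rewrite E /path_label map_cat /=.
elim: p1 {E} => [|f p1 IHp /=]; last by move/freely_reduced_behead.
by rewrite /freely_reduced /= /hlabel /letter_inv /= eqxx.
Qed.

(** The words that fix all vertices form a normal subgroup. *)
Lemma walk_relator (rels : set (freegroup X)) : fulfills_relators Gamma rels ->
  normal_closure rels `<=` [set u : freegroup X | forall v, walk v u = v].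
Proof.
move=> ful; apply: smallest_sub.
  split; first apply/subgroupP; first split=> //=.
  - by move=> x y Wx Wy v; rewrite [LHS]walkM Wx Wy.
  - by move=> x Wx v; rewrite -{1}(Wx v) walkVK.
  - move=> x y Wx v; rewrite [LHS]walkM [LHS]walkM Wx.
    by have := walkVK v (y^-1)%g; rewrite invgK.
move=> r Rr v; rewrite -[in LHS](walk_path_label v r) -path_walk.
  apply: (ful v r Rr); first exact: walk_path_from.
    by apply: reduced_label_path; rewrite walk_path_label; exact: wordP.
  exact: walk_path_label.
exact: walk_path_from.
Qed.

End RegularGraph.

Section Stabilizer.
Local Open Scope group_scope.
Variables (X : choiceType) (G : groupType) (gen : X -> G).
Variables (rels : set (freegroup X)) (Gamma : xgraph X).
Hypotheses (presG : presentation rels gen) (regular : xregular Gamma).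
Hypothesis ful : fulfills_relators Gamma rels.
Implicit Types (v : vertex Gamma) (x y : freegroup X).

Local Notation eval := (freegroup_eval gen).
Local Notation walk := (walk regular).

Lemma freegroup_eval1 : eval 1 = 1.
Proof. by rewrite /freegroup_eval big_nil. Qed.

Lemma freegroup_evalV x : eval x^-1 = (eval x)^-1.
Proof.
apply: (mulIg (eval x)); rewrite -freegroup_evalM !mulVg.
exact: freegroup_eval1.
Qed.

Lemma freegroup_evalX x n : eval (x ^+ n) = eval x ^+ n.
Proof.
elim: n => [|n IHn]; first exact: freegroup_eval1.
by rewrite !expgS freegroup_evalM IHn.
Qed.

(** The action of the free group on the vertices descends to [G]. *)
Lemma walk_eval v x y : eval x = eval y -> walk v x = walk v y.
Proof.
move=> Exy; have [_ ker] := presG.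
have : (eval @^-1` [set 1]) (x * y^-1).
  by rewrite /= freegroup_evalM freegroup_evalV Exy mulgV.
rewrite ker => /(walk_relator regular ful) /(_ v).
by rewrite walkM => E; rewrite -[in RHS]E -walkM mulVg.
Qed.

Definition stabilizer v : set G :=
  [set g | exists2 x, eval x = g & walk v x = v].

Lemma stabilizerE v x : stabilizer v (eval x) <-> walk v x = v.
Proof.
split=> [[y Exy vy]|vx]; last by exists x.
by rewrite -[RHS]vy; exact: walk_eval.
Qed.

Lemma subgroup_stabilizer v : subgroup (stabilizer v).
Proof.
apply/subgroupP; split.
- by exists 1; [exact: freegroup_eval1|].
- move=> _ _ [x <- vx] [y <- vy].
  by rewrite -freegroup_evalM; apply/stabilizerE; rewrite walkM vx vy.
- move=> _ [x <- vx]; rewrite -freegroup_evalV; apply/stabilizerE.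
  by rewrite -{1}vx walkVK.
Qed.

End Stabilizer.

(** * Powers of a cyclic permutation of prime order *)

Section PowerTransitivity.
Local Open Scope group_scope.
Variables (X : choiceType) (Gamma : xgraph X) (regular : xregular Gamma).
Variables (p : nat) (v : vertex Gamma) (w : freegroup X).
Hypothesis p_prime : prime p.
Hypothesis card_p : ([set: vertex Gamma] #= `I_p)%card.
Hypothesis power_w : power_termini v w p = [set: vertex Gamma].

Local Notation T n := (walk regular v (w ^+ n)).

Lemma power_walk u : exists2 n, (n < p)%N & T n = u.
Proof.
have : [set: vertex Gamma] u by [].
rewrite -power_w => -[n np [q [qv _ ql <-]]]; exists n => //.
by rewrite -ql -path_walk.
Qed.

Lemma power_walkD m n : T (m + n) = walk regular (T m) (w ^+ n).
Proof. by rewrite expgnDr walkM. Qed.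

Lemma power_walk_mod d n : T d = v -> T (n %% d) = T n.
Proof.
move=> Td; rewrite [in RHS](divn_eq n d) power_walkD.
by elim: (n %/ d)%N => [//|k ->]; rewrite mulSn power_walkD Td.
Qed.

(** The powers of [w] before a period already reach all [p] vertices. *)
Lemma power_walk_period d : (0 < d)%N -> T d = v -> (p <= d)%N.
Proof.
move=> d0 Td; rewrite -card_le_II; move/card_eqPle: card_p => [_ leI].
apply: card_le_trans leI _; apply: card_le_trans (card_image_le (fun n => T n) _).
apply: subset_card_le => u _; have [n _ <-] := power_walk u.
by exists (n %% d)%N; [exact: ltn_pmod|exact: power_walk_mod].
Qed.

Lemma power_walk_p : T p = v.
Proof.
have [i ip Ti] := power_walk (T p).
have Tpi : T (p - i) = v.
  rewrite expgnFr ?(ltnW ip) // walkM -Ti; exact: walkVK.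
have [i0|i0] := posnP i; first by rewrite -Ti i0.
have : (p <= p - i)%N by apply: power_walk_period Tpi; rewrite subn_gt0.
by lia.
Qed.

(** [w] acts as a [p]-cycle, and a power of a [p]-cycle whose exponent is prime
    to [p] is again a [p]-cycle. *)
Lemma power_walk_transitive m u : (0 < m < p)%N ->
  exists n, T (m * n) = u.
Proof.
move=> /andP[m0 mp]; have [i ip <-] := power_walk u.
have co : coprime m p by rewrite coprime_sym prime_coprime // gtnNdvd.
case: (egcdnP p m0) => a b ab _; exists (a * i)%N.
rewrite -(power_walk_mod _ power_walk_p) -[in RHS](power_walk_mod i power_walk_p).
(* By Bezout, [a] is an inverse of [m] modulo [p]. *)
suff -> : (m * (a * i) = i %[mod p])%N by [].
move: co; rewrite /coprime => /eqP co; rewrite co in ab.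
by rewrite mulnA (mulnC m) ab mulnDl mul1n -mulnA (mulnC p) mulnA modnMDl.
Qed.

End PowerTransitivity.

(** * Subgroups that meet all cosets *)

Section Transversal.
Local Open Scope group_scope.
Variable G : groupType.
Implicit Types H K L : set G.

Definition finite_index_subgroup H L : Prop :=
  [/\ subgroup L, L `<=` H & coset_reps [set: G] L].

(** The last clause says that [K] meets the coset of [L] through any point of
    [H]; equivalently, [L] acts transitively on the cosets of [K]. *)
Definition transversal H L K : Prop :=
  [/\ finite_index_subgroup H K, K `<` H &
      forall x, H x -> exists2 l, L l & K (l * x)].

(** Since [L] has fewer than [p] cosets, it contains a power of [w] with
    exponent between 1 and [p - 1], so it is transitive on the [p] vertices.
    It then moves [v], and the stabilizer does not contain [H].  To meet
    the coset of [x], move [v] by [L] to its image under the inverse of [x]. *)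
Lemma stabilizer_transversal (X : choiceType) (gen : X -> G)
    (rels : set (freegroup X)) (Gamma : xgraph X) (regular : xregular Gamma)
    (v : vertex Gamma) (w : freegroup X) (p : nat) H L (s : seq G) :
  presentation rels gen -> fulfills_relators Gamma rels -> prime p ->
  ([set: vertex Gamma] #= `I_p)%card ->
  power_termini v w p = [set: vertex Gamma] ->
  subgroup H -> subgroup L -> L `<=` H ->
  (forall y, exists2 g, g \in s & L (y / g)) -> (size s < p)%N ->
  transversal H L (stabilizer gen regular v `&` H).
Proof.
move=> presG ful p_prime card_p power_w sH sL LH Ls sp.
have [m /andP[m0 ms] Lm] := coset_reps_power (freegroup_eval gen w) sL Ls.
have trans u :
    exists2 x : freegroup X, L (freegroup_eval gen x) & walk regular v x = u.
  have m0p : (0 < m < p)%N by rewrite m0 (leq_ltn_trans ms).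
  have [n <-] := power_walk_transitive regular p_prime card_p power_w u m0p.
  exists (w ^+ (m * n)) => //; rewrite freegroup_evalX expgnA.
  elim: n => [|n IHn]; first exact: subgroup1.
  by rewrite expgS; exact: subgroupM.
have sS := subgroup_stabilizer presG regular ful v.
have surj x : exists u : freegroup X, freegroup_eval gen u = x.
  have [surj _] := presG; have : [set: G] x by [].
  by rewrite -surj => -[u _ <-]; exists u.
have rS : coset_reps [set: G] (stabilizer gen regular v).
  exists [seq freegroup_eval gen w ^+ n | n <- iota 0 p] => x _.
  have [u <-] := surj x.
  have [n np Tn] := power_walk regular power_w (walk regular v u).
  exists (freegroup_eval gen w ^+ n); first by apply: map_f; rewrite mem_iota.
  rewrite -freegroup_evalX -freegroup_evalV -freegroup_evalM.
  by apply/(stabilizerE presG regular ful); rewrite walkM -Tn walkVK.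
split.
- split; [exact: subgroupI|by move=> x []|].
  apply: coset_repsI => //.
  apply: coset_reps_sub (@subset_refl _ [set: G]) LH _.
  by exists s => y _; exact: Ls.
- split; first by move=> x [].
  move=> HS.
  have [x Lx vx] := trans (walk regular v (w ^+ 1)).
  have [/(stabilizerE presG regular ful) xv _] := HS _ (LH _ Lx).
  have := power_walk_period card_p power_w (ltn0Sn 0) (etrans (esym vx) xv).
  by rewrite leqNgt prime_gt1.
- move=> x Hx; have [u ux] := surj x.
  have [y Ly vy] := trans (walk regular v (u^-1)).
  exists (freegroup_eval gen y) => //; split; last first.
    by apply: subgroupM => //; exact: LH.
  rewrite -ux -freegroup_evalM; apply/(stabilizerE presG regular ful).
  by rewrite walkM vy -walkM mulVg.
Qed.

End Transversal.

(** * The nerve and the order complex of cosets *)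

Section CosetNerve.
Local Open Scope group_scope.
Variables (R : realType) (G : groupType) (H : set G).
Hypothesis sH : subgroup H.
Implicit Types (K L : set G).

Local Notation Hfi := (proper_finite_index_subgroups H).

Definition translation_invariant L : set (set G) :=
  [set C : set G | forall l x, L l -> C x -> C (l * x)].

(** The cosets of subgroups that contain [L n] are [L n]-invariant, and an
    [L n]-invariant set that meets [H] meets [K n].  The vertex maps of the
    telescope are [f n], which collapses to [K n] everything that is not yet
    invariant. *)
Lemma nerve_contractible (L K : nat -> set G) :
  (forall n, finite_index_subgroup H (L n)) ->
  (forall n, transversal H (L n) (K n)) ->
  (forall n, L n.+1 `<=` L n `&` K n) ->
  (forall M, Hfi M -> exists n, L n `<=` M) ->
  contractible R (realization R (nerve_complex H Hfi)).
Proof.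
move=> gL tK decL cofL.
have anti m n : (m <= n)%N -> L n `<=` L m.
  elim: n => [|n IHn]; first by rewrite leqn0 => /eqP ->.
  rewrite leq_eqVlt => /predU1P[-> //|/IHn nm].
  by apply: subset_trans nm => x /decL[].
have KHfi n : Hfi (K n).
  have [[sK KH rK] prop _] := tK n; split=> //.
  by apply/coset_repsP => //; exact: coset_reps_sub rK.
have Kcoset n : right_cosets H Hfi (K n).
  exists (K n), 1; split=> //; first exact: subgroup1.
  apply/seteqP; split=> x; first by move=> Kx; apply/right_cosetE; rewrite divg1.
  by move/right_cosetE; rewrite divg1.
(* [B] is shifted by one so that [B 0] is empty and [f 0] is constant. *)
pose B n := if n is m.+1 then translation_invariant (L m) else set0.
have BS n : B n `<=` B n.+1.
  case: n => [//|n] C BC l x Ll; apply: BC; exact: anti (leqnSn n) _ Ll.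
pose f n C := if `[< B n C >] then C else K n.
have fB n C : B n C -> f n C = C by move=> BC; rewrite /f asboolT.
have fS n C : f n C = K n \/ B n C /\ f n C = C.
  by rewrite /f; case: asboolP => BC; [right|left].
apply: (@contractible_telescope _ _ _ f (K 0%N)).
- split; [exact: finite_set1|by exists (K 0%N)|by move=> _ ->|].
  by exists 1 => _ ->; apply: subgroup1; have [[]] := tK 0%N.
- by move=> C; have [//|[]] := fS 0%N C.
- move=> S n [finS S0 Scos [x Sx]].
  have Hx : H x.
    have [C SC] := S0; have [M [h [[sM [MH _] _] Hh CE]]] := Scos C SC.
    have := Sx C SC; rewrite CE => -[k Mk <-]; apply: subgroupM => //; exact: MH.
  have [_ _ trans] := tK n; have [_ _ trans'] := tK n.+1.
  (* From a common point [x] of a simplex, a common point of the images under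
     [f n] and [f n.+1]: first move into [K n] by [L n], then into [K n.+1] by
     [L n.+1], which preserves [K n]. *)
  have [l Ll Klx] := trans x Hx.
  have [_ LH _] := gL n.
  have [l' Ll' Kl'] := trans' (l * x) (subgroupM sH (LH _ Ll) Hx).
  have [Lnl' Knl'] := decL n l' Ll'.
  have [[sKn _ _] _ _] := tK n.
  have image D : (f n @` S `|` f n.+1 @` S) D ->
      D = K n \/ D = K n.+1 \/ S D /\ B n.+1 D.
    case=> -[C SC <-].
      by have [->|[/BS BC ->]] := fS n C; [left|right; right].
    by have [->|[BC ->]] := fS n.+1 C; [right; left|right; right].
  split.
  + by rewrite finite_setU; split; exact: finite_image.
  + by have [C SC] := S0; exists (f n C); left; exists C.
  + by move=> D /image[->|[->|[/Scos]]].
  + exists (l' * (l * x)) => D /image[->|[->|[SD BD]]] //.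
      exact: subgroupM.
    by apply: (BD) => //; apply: (BD) => //; exact: Sx.
- move=> S C [_ _ Scos _] /Scos[M [h [HM Hh ->]]].
  have [N LN] := cofL M HM; have [sM _ _] := HM.
  exists N.+1 => -[//|j] Nj; apply: fB => l x Ll [k Mk <-].
  exists (l * k); last by rewrite mulgA.
  by apply: subgroupM => //; exact: LN (@anti N j Nj l Ll).
Qed.

Lemma order_simplexP (P S : set (set G)) : order_simplices P S <->
  [/\ finite_set S, S !=set0, S `<=` P &
      forall C D, S C -> S D -> C `<=` D \/ D `<=` C].
Proof.
split=> [oS|[finS S0 SP tot]].
  have finS := order_finite oS; have S0 := order_neq0 oS.
  move: oS => [s [_ ss sP E]]; split=> //; first by rewrite E.
  move=> C D; rewrite E /= => Cs Ds.
  move: ss; rewrite lt_sorted_pairwise => /(pairwiseP set0) pw.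
  move: Cs Ds => /(nthP set0)[i si <-] /(nthP set0)[j sj <-].
  have [ij|ji|->] := ltngtP i j; last by left.
    by left; rewrite -subsetEset; apply/ltW/pw.
  by right; rewrite -subsetEset; apply/ltW/pw.
pose s := sort <=%O (fset_set S : seq (set G)).
have sE : [set` s] = S.
  by rewrite -[RHS]fset_setK //; apply/seteqP; split=> C /=; rewrite mem_sort.
exists s; split.
- by apply/eqP => s0; move: S0; rewrite -sE s0 => -[].
- rewrite lt_sorted_uniq_le sort_uniq fset_uniq /=.
  apply: (@sort_sorted_in _ (mem (fset_set S))); last by apply/allP.
  move=> C D CS DS.
  have SC : S C by rewrite -sE /= mem_sort; exact: CS.
  have SD : S D by rewrite -sE /= mem_sort; exact: DS.
  by apply/orP; have [CD|DC] := tot C D SC SD; [left|right]; apply/subsetPset.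
- by rewrite sE.
- by [].
Qed.

(** A finite chain has a least element, which is the intersection. *)
Lemma chain_least (s : {fset (set G)}) : s != fset0 ->
  (forall C D, C \in s -> D \in s -> C `<=` D \/ D `<=` C) ->
  \bigcap_(C in [set` s]) C \in s.
Proof.
move=> s0 tot.
have [C Cs leC] : exists2 C, C \in s & forall D, D \in s -> C `<=` D.
  have [C0 C0s] := fset0Pn _ s0.
  suff H' (t : seq (set G)) : {subset t <= s} ->
      exists2 C, C \in s & forall D, D \in C0 :: t -> C `<=` D.
    have [C Cs HC] := H' s (fun _ => id); exists C => // D Ds.
    by apply: HC; rewrite inE Ds orbT.
  elim: t => [_|D t IHt ts]; first by exists C0 => // D; rewrite inE => /eqP ->.
  have [|C Cs HC] := IHt; first by move=> E Et; apply: ts; rewrite inE Et orbT.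
  have Ds : D \in s by apply: ts; rewrite mem_head.
  have [CD|DC] := tot C D Cs Ds; [exists C|exists D] => // E;
    rewrite !inE orbCA => /orP[/eqP -> //|Et].
    by apply: HC; rewrite inE.
  by apply: subset_trans DC _; apply: HC; rewrite inE.
suff -> : \bigcap_(C in [set` s]) C = C by [].
by apply/seteqP; split=> [x|x Cx D /leC]; [apply|apply].
Qed.

(** A coset that contains [x] is the translate of its subgroup by [x], so the
    intersection of cosets through a common point [x] is the translate by [x]
    of the intersection of their subgroups. *)
Lemma finite_intersection_coset (s : {fset (set G)}) : s != fset0 ->
  [set` s] `<=` proper_finite_index_cosets H ->
  \bigcap_(C in [set` s]) C !=set0 ->
  proper_finite_index_cosets H (\bigcap_(C in [set` s]) C).
Proof.
move=> /fset0Pn[C0 C0s] sP [x xs].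
have Ks C : C \in s -> exists2 M, Hfi M & C = right_coset M x.
  move=> Cs; have [M [h [HM Hh CE]]] := sP C Cs; exists M => //.
  have [sM _ _] := HM; rewrite CE; apply/esym/right_coset_eq => //.
  by apply/right_cosetE; rewrite -CE; exact: xs.
(* [F C] is the subgroup whose coset through [x] is [C]. *)
pose F (C : set G) := [set k | C (k * x)].
have FHfi C : C \in s -> Hfi (F C).
  move=> Cs; have [M HM CE] := Ks C Cs; suff -> : F C = M by [].
  apply/seteqP; split=> k; rewrite /F /= CE => Mk.
    by move/right_cosetE: Mk; rewrite mulgK.
  by apply/right_cosetE; rewrite mulgK.
have Hx : H x.
  have [M [h [[sM [MH _] _] Hh CE]]] := sP C0 C0s.
  have := xs C0 C0s; rewrite CE => -[k Mk <-]; apply: subgroupM => //; exact: MH.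
pose N := [set k | forall C, C \in s -> F C k].
have sF C : C \in s -> subgroup (F C) by move=> /FHfi[].
have sN : subgroup N := subgroup_big sF.
have NF : N `<=` F C0 by move=> k; apply.
exists N, x; split=> //.
  split=> //.
    have [_ [FH nHF] _] := FHfi C0 C0s.
    by split; [exact: subset_trans FH|move=> HN; apply: nHF; exact: subset_trans NF].
  apply/coset_repsP => //; apply: coset_reps_big => // C Cs.
  by have [sFC _ fFC] := FHfi C Cs; apply/coset_repsP.
apply/seteqP; split=> y.
  move=> yC; apply/right_cosetE => C Cs; rewrite /F /= mulgVK; exact: yC.
by move=> /right_cosetE Ny C Cs; have := Ny C Cs; rewrite /F /= mulgVK.
Qed.

(** A chain is a simplex of the nerve, since its least element is nonempty;
    and a larger simplex of the nerve has a smaller intersection, so that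
    intersections turn chains of simplices into chains of cosets. *)
Lemma order_contractible :
  contractible R (realization R (nerve_complex H Hfi)) ->
  contractible R (realization R (order_complex (proper_finite_index_cosets H))).
Proof.
apply: (@contractible_subcomplex _ _ _ _
    (fun s : {fset set G} => \bigcap_(C in [set` s]) C)).
- move=> S oS; have /order_simplexP[finS S0 SP tot] := oS; split=> //.
  have := @chain_least (fset_set S); rewrite fset_setK // => least.
  have /SP[M [h [[sM _ _] _ E]]] : S (\bigcap_(C in S) C).
    apply/set_mem; rewrite -in_fset_set //; apply: least.
      by have [C SC] := S0; apply/fset0Pn; exists C; rewrite in_fset_set // inE.
    by move=> C D; rewrite !in_fset_set // => /set_mem SC /set_mem SD; exact: tot.
  exists h; rewrite E; apply/right_cosetE; rewrite mulgV; exact: subgroup1.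
- move=> Cs finC C0 Csimp Cnest; apply/order_simplexP; split.
  + exact: finite_image.
  + by have [s Cs_s] := C0; eexists; exists s.
  + move=> _ [s Cs_s <-]; have [_ s0 sP I0] := Csimp s Cs_s.
    apply: finite_intersection_coset => //.
    by have [C Cin] := s0; apply/fset0Pn; exists C.
  + move=> _ _ [s Cs_s <-] [s' Cs_s' <-].
    by have [/fsubsetP ss'|/fsubsetP ss'] := Cnest s s' Cs_s Cs_s'; [right|left];
      move=> x xs C Cin; apply: xs; exact: ss'.
- move=> s /order_simplexP[_ s0 _ tot]; apply: chain_least => //.
  by have [C Cin] := s0; apply/fset0Pn; exists C.
Qed.

End CosetNerve.

(** [L n.+1] is cut down from [L n] by its own transversal [K n], as the
    contiguity of consecutive vertex maps requires, and by the [n]-th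
    subgroup of an enumeration of all finite index subgroups. *)
Lemma cofinal_transversals (G : groupType) (H : set G) (e : nat -> set G) :
  subgroup H -> coset_reps [set: G] H ->
  (forall M, subgroup M -> coset_reps [set: G] M -> exists n, e n = M) ->
  (forall L, finite_index_subgroup H L -> exists K, transversal H L K) ->
  exists L K : nat -> set G,
    [/\ forall n, finite_index_subgroup H (L n),
        forall n, transversal H (L n) (K n),
        forall n, L n.+1 `<=` L n `&` K n &
        forall M, proper_finite_index_subgroups H M -> exists n, L n `<=` M].
Proof.
move=> sH rH enum trans.
have /choice[k kT] :
    forall L, exists K, finite_index_subgroup H L -> transversal H L K.
  move=> L; have [fL|nL] := pselect (finite_index_subgroup H L); last by exists L.
  by have [K HK] := trans L fL; exists K.
pose U n := if `[< subgroup (e n) /\ coset_reps [set: G] (e n) >] then e n else setT.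
have UP n : subgroup (U n) /\ coset_reps [set: G] (U n).
  rewrite /U; case: asboolP => // _; split; first by apply/subgroupP; split.
  by exists [:: 1%g] => x _; exists 1%g; rewrite ?mem_head.
pose L := fix L n := if n is m.+1 then L m `&` k (L m) `&` U m else H.
have fL n : finite_index_subgroup H (L n).
  elim: n => [|n IHn] /=; first by split.
  have [[sk _ rk] _ _] := kT _ IHn; have [sU rU] := UP n; have [sL LH rL] := IHn.
  split; first by apply: subgroupI => //; exact: subgroupI.
    by move=> x [[/LH]].
  by apply: coset_repsI => //; [exact: subgroupI|exact: coset_repsI].
exists L, (k \o L); split=> // [n|n x [] //|M [sM [MH _] fM]]; first exact: kT.
have rM : coset_reps [set: G] M.
  by apply: coset_reps_trans rH _; exact/coset_repsP.
have [n en] := enum M sM rM; exists n.+1 => x [_].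
by rewrite /U asboolT ?en.
Qed.

Theorem theorem6p1 (R : realType) (X : finType) (rels : set (freegroup X))
    (G : groupType) (gen : X -> G) (P : set nat) (w : freegroup X)
    (Gamma : nat -> xgraph X) (H : set G)
    (presG : presentation rels gen)
    (P_infinite : infinite_set P)
    (P_prime : forall p, P p -> prime p)
    (Gamma_p : forall p, P p ->
       [/\ xregular (Gamma p), xconnected (Gamma p),
           fulfills_relators (Gamma p) rels,
           ([set: vertex (Gamma p)] #= `I_p)%card
         & exists v : vertex (Gamma p),
             power_termini v w p = [set: vertex (Gamma p)]])
    (subH : subgroup H)
    (indexH : finite_index [set: G] H) :
  contractible R
    (realization R (nerve_complex H (proper_finite_index_subgroups H))) /\
  contractible R
    (realization R (order_complex (proper_finite_index_cosets H))).
Proof.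
have [e enum] := countable_finite_index (let: conj surj _ := presG in surj).
have trans L : finite_index_subgroup H L -> exists K, transversal H L K.
  move=> [sL LH [s Ls]].
  (* A prime that exceeds the index of [L], as [P] is infinite. *)
  have [p Pp sp] : exists2 p, P p & (size s < p)%N.
    apply: contrapT => nP; apply: P_infinite.
    apply: (@sub_finite_set _ _ `I_(size s).+1); last exact: finite_II.
    move=> p Pp /=; rewrite ltnS leqNgt; apply/negP => sp; apply: nP.
    by exists p.
  have [reg _ ful card_p [v power_w]] := Gamma_p p Pp.
  exists (stabilizer gen reg v `&` H).
  by apply: stabilizer_transversal presG ful (P_prime p Pp) card_p power_w subH
    sL LH (fun y => Ls y I) sp.
have rH : coset_reps [set: G] H by exact/coset_repsP.
have [L [K [fL tK decL cofL]]] := cofinal_transversals subH rH enum trans.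
have nerve := nerve_contractible R subH fL tK decL cofL.
by split=> //; exact: order_contractible nerve.
Qed.
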